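(* Let $\rho\in\mathbb{C}\setminus\{0\}$, and let $W_1(y,z,\rho)$ and $W_2(z,\rho)$ be the $2\times 2$ matrix functions defined in the context, constructed from linearly independent solutions $\psi_1,\psi_2$ of the Gauss hypergeometric equation $$v(1-v)\psi''(v)+[\gamma-(\alpha+\beta+1)v]\psi'(v)-\alpha\beta\,\psi(v)=0,\qquad \alpha=-\rho,\ \beta=-3\rho,\ \gamma=1-2\rho .$$ Then the $2\times 2$ matrix function $$W(y,z,\rho)=W_1(y,z,\rho)\,W_1^{-1}(0,z,\rho)\,W_2(z,\rho)$$ is a fundamental solution of the Knizhnik–Zamolodchikov system $$\frac{\partial W}{\partial y}=\rho\left(\frac{P_{1,3}}{1+y}+\frac{P_{1,4}(1+z)}{1+y+yz}\right)W,\qquad \frac{\partial W}{\partial z}=\rho\left(\frac{P_{4,3}}{z}+\frac{P_{4,2}}{1+z}+\frac{P_{4,1}\,y}{1+y+yz}\right)W .$$ If $\rho$ is an integer, this fundamental solution is rational (i.e. all entries of $W$ are rational functions of $y$ and $z$).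
   Context: The matrices $P_{i,j}=P_{j,i}$ are the images of the transpositions $(i\,j)$ in the following irreducible $2$-dimensional representation of the symmetric group $S_4$: $$P_{1,2}=P_{3,4}=\begin{pmatrix}1&0\\0&-1\end{pmatrix},\quad P_{2,4}=P_{1,3}=\begin{pmatrix}-1/2&-\sqrt3/2\\-\sqrt3/2&1/2\end{pmatrix},\quad P_{2,3}=P_{1,4}=\begin{pmatrix}-1/2&\sqrt3/2\\ \sqrt3/2&1/2\end{pmatrix}.$$ Constant vectors: $w_1=\mathrm{col}[\sqrt3,1]$, $w_2=\mathrm{col}[1,\sqrt3]$, $v_1=\mathrm{col}[0,2]$, $v_2=\mathrm{col}[1,-\sqrt3]$. Definition of $W_1$: with $s=\frac{(y+1)(z+1)}{z}$ and $k=1,2$, put $$Y_k(y,z,\rho)=(1+y)^{-\rho}(1+y+yz)^{-\rho}\Big[\psi_k(s)\,w_1-\frac{s}{\sqrt3\,\rho}\,\psi_k'(s)\,w_2\Big],\qquad W_1(y,z,\rho)=[Y_1(y,z,\rho),\,Y_2(y,z,\rho)].$$ Definition of $W_2$: for $k=1,2$ put $$U_k(z,\rho)=\Big[\psi_k(-z)\,v_1-\frac{z}{\sqrt3\,\rho}\,\psi_k'(-z)\,v_2\Big]z^{-\rho}(1+z)^{-\rho},\qquad W_2(z,\rho)=[U_1(z,\rho),\,U_2(z,\rho)].$$ For non-integer $\rho$ the functions are understood locally: $(y,z)$ ranges over a product $D_1\times D_2$ of open discs with $0\in D_1$, on which $z\neq0$, $z\neq-1$, $y\ne-1$, $1+y+yz\neq0$;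 analytic branches of the powers, and of $\psi_k$ along $s$ and along $-z$ (continued as linearly independent solutions), are fixed there. For integer $\rho$, $\psi_1,\psi_2$ are linearly independent rational solutions of the hypergeometric equation. A fundamental solution is a matrix solution that is invertible at every point of the domain considered. *)

(* Defs.v *)
From HB Require Import structures.
From mathcomp Require Import all_boot all_order all_algebra complex.
From mathcomp Require Import all_classical all_reals all_analysis.

Set Implicit Arguments.
Unset Strict Implicit.
Unset Printing Implicit Defensive.

Import Order.TTheory GRing.Theory Num.Theory numFieldNormedType.Exports.

Local Open Scope ring_scope.
Local Open Scope classical_set_scope.
Local Open Scope complex_scope.

(* The complex numbers R[i], regarded as a normed module over themselves, so
   that [derivable], [is_derive], [differentiable] and the derivatives [derive1 f]
   are the complex ones. *)
Notation Cx R := (R[i]^o).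

Section Complex.
Variable R : realType.
Notation C := (Cx R).

Definition cexp (z : C) : C :=
  (expR (complex.Re z) * cos (complex.Im z))
    +i* (expR (complex.Re z) * sin (complex.Im z)).

Definition disc (c : C) (r : R) : set C := [set z | `|z - c| < r%:C].

(* [P] is an analytic branch on [X] of the power u ^ a: it is exp (a log u)
   for an analytic branch of log u. *)
Definition power_branch (V : normedModType R[i]) (X : set V)
    (u : V -> C) (a : C) (P : V -> C) : Prop :=
  exists logu : V -> C, forall x, X x ->
    [/\ differentiable logu x, cexp (logu x) = u x & P x = cexp (a * logu x)].

Definition lin_indep_on (T : Type) (X : set T) (f : 'I_2 -> T -> C) : Prop :=
  forall a : 'I_2 -> C,
    (forall x, X x -> \sum_k a k * f k x = 0) -> forall k, a k = 0.

(* Rational functions without poles in the given set. In two variables, the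
   outer indeterminate stands for y and the inner one for z. *)
Definition rational_on (X : set C) (f : C -> C) : Prop :=
  exists p q : {poly R[i]},
    forall v, X v -> q.[v] != 0 /\ f v = p.[v] / q.[v].

Definition rational2_on (X : set (C * C)) (f : C -> C -> C) : Prop :=
  exists p q : {poly {poly R[i]}}, forall y z, X (y, z) ->
    q.[y%:P].[z] != 0 /\ f y z = p.[y%:P].[z] / q.[y%:P].[z].

(* [f] solves the Gauss hypergeometric equation at the point [v]. *)
Definition gauss_at (alpha beta gamma : C) (f : C -> C) (v : C) : Prop :=
  [/\ derivable f v 1, derivable (derive1 f) v 1 &
      v * (1 - v) * derive1n 2 f v + (gamma - (alpha + beta + 1) * v) * derive1 f v
        - alpha * beta * f v = 0].

End Complex.

Section KZ.
Variable R : realType.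
Notation C := (Cx R).
Variable rho : C.

Definition psi_eq_at : (C -> C) -> C -> Prop :=
  gauss_at (- rho) (- (3 * rho)) (1 - 2 * rho).

(* [F] is a branch over [X] of a solution of the hypergeometric equation along
   the map [phi], and [F'] the branch of its derivative: near each point of [X],
   F = psi \o phi and F' = psi' \o phi for some local solution psi. *)
Definition solution_along (T : topologicalType) (X : set T)
    (phi F F' : T -> C) : Prop :=
  forall p, X p -> exists psi : C -> C,
    (\forall v \near phi p, psi_eq_at psi v) /\
    (\forall q \near within X (nbhs p),
       F q = psi (phi q) /\ F' q = derive1 psi (phi q)).

(* [F], [F'] is obtained from the germ of [psi] at [b] by analytic continuation
   along a path [g] in C \ {0, 1}, and then along [phi]. A germ of a solution is
   determined by its value and its derivative, so these are what is matched at
   the endpoints of [g]. *)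
Definition continued_along (psi : C -> C) (b : C) (T : topologicalType)
    (X : set T) (phi F F' : T -> C) : Prop :=
  solution_along X phi F F' /\
  let I : set R := `[0, 1] in
  exists (p : T) (g G G' : R -> C),
    [/\ X p, g 0 = b /\ g 1 = phi p,
        {within I, continuous g} /\
          (forall t, I t -> g t != 0 /\ g t != 1),
        solution_along I g G G' &
        [/\ G 0 = psi b, G' 0 = derive1 psi b, G 1 = F p & G' 1 = F' p]].

Definition sqrt3 : R[i] := (Num.sqrt 3)%:C.

Definition col2 (a b : R[i]) : 'cV[R[i]]_2 := \col_i (if i == 0 then a else b).

Definition mx2 (a b c d : R[i]) : 'M[R[i]]_2 :=
  \matrix_(i, j) (if i == 0 then if j == 0 then a else b
                  else if j == 0 then c else d).

Definition P12 := mx2 1 0 0 (-1).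
Definition P13 := mx2 (- (1 / 2)) (- (sqrt3 / 2)) (- (sqrt3 / 2)) (1 / 2).
Definition P14 := mx2 (- (1 / 2)) (sqrt3 / 2) (sqrt3 / 2) (1 / 2).

Definition P (i j : nat) : 'M[R[i]]_2 :=
  match i, j with
  | 1, 2 | 2, 1 | 3, 4 | 4, 3 => P12
  | 1, 3 | 3, 1 | 2, 4 | 4, 2 => P13
  | 1, 4 | 4, 1 | 2, 3 | 3, 2 => P14
  | _, _ => 0
  end.

Definition w1 := col2 sqrt3 1.
Definition w2 := col2 1 sqrt3.
Definition v1 := col2 0 2.
Definition v2 := col2 1 (- sqrt3).

Definition s (p : C * C) : C := (p.1 + 1) * (p.2 + 1) / p.2.

Definition kz_domain : set (C * C) :=
  [set p | [/\ p.2 != 0, p.2 != -1, p.1 != -1 & 1 + p.1 + p.1 * p.2 != 0]].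

(* The branches used in the construction are parameters:
   [a y] stands for (1 + y)^(-rho), [b (y, z)] for (1 + y + yz)^(-rho),
   [F k], [F' k] for psi_k, psi_k' along s;
   [c z] stands for z^(-rho), [d z] for (1 + z)^(-rho),
   [H k], [H' k] for psi_k, psi_k' along -z. *)
Definition Yvec (a : C -> C) (b F F' : C * C -> C) (y z : C) : 'cV[R[i]]_2 :=
  (a y * b (y, z)) *:
    (F (y, z) *: w1 - (s (y, z) / (sqrt3 * rho) * F' (y, z)) *: w2).

Definition W1 (a : C -> C) (b : C * C -> C) (F F' : 'I_2 -> C * C -> C)
    (y z : C) : 'M[R[i]]_2 :=
  \matrix_(i, k) Yvec a b (F k) (F' k) y z i 0.

Definition Uvec (c d H H' : C -> C) (z : C) : 'cV[R[i]]_2 :=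
  (c z * d z) *: (H z *: v1 - (z / (sqrt3 * rho) * H' z) *: v2).

Definition W2 (c d : C -> C) (H H' : 'I_2 -> C -> C) (z : C) : 'M[R[i]]_2 :=
  \matrix_(i, k) Uvec c d (H k) (H' k) z i 0.

Definition W (a : C -> C) (b : C * C -> C) (F F' : 'I_2 -> C * C -> C)
    (c d : C -> C) (H H' : 'I_2 -> C -> C) (y z : C) : 'M[R[i]]_2 :=
  W1 a b F F' y z *m invmx (W1 a b F F' 0 z) *m W2 c d H H' z.

Definition kz_fundamental_on (X : set (C * C)) (V : C -> C -> 'M[R[i]]_2) :
    Prop :=
  forall y z, X (y, z) ->
    [/\ V y z \in unitmx,
        (forall i j, is_derive y (1 : C) (fun y' => V y' z i j : C)
           ((rho *: ((1 + y)^-1 *: P 1 3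
                     + ((1 + z) / (1 + y + y * z)) *: P 1 4)
             *m V y z) i j)) &
        (forall i j, is_derive z (1 : C) (fun z' => V y z' i j : C)
           ((rho *: (z^-1 *: P 4 3 + (1 + z)^-1 *: P 4 2
                     + (y / (1 + y + y * z)) *: P 4 1)
             *m V y z) i j))].

End KZ.

(* Main.v *)
(** Since P12 + P13 + P14 = 0 on this representation, the system depends on
    (y, z) only through s = (y + 1)(z + 1)/z: it is the pull-back of
    Phi' = rho (P13 / s + P14 / (s - 1)) Phi.  The hypergeometric equation turns
    psi w1 - s/(sqrt 3 rho) psi' w2, times (s (s - 1))^(-rho), into a solution of
    this equation, so W1 equals such a Phi (s) up to the scalar factor
    ((1 + z)/z^2)^rho, which cancels in W1(y,z) W1(0,z)^(-1); W2 solves the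
    z-equation at y = 0.  Invertibility amounts to the nonvanishing of Wronskians,
    which is uniqueness for linear ODEs.  For integer rho, W is Phi (s) times a
    constant matrix, for any rational fundamental solution Phi.  For rho = n > 0
    one gets Phi from polynomial solutions psi of degrees n and 3n; for
    rho = -n its inverse transpose does, as P13 and P14 are symmetric. *)

Require Import Defs.
From HB Require Import structures.
From mathcomp Require Import all_boot all_order all_algebra complex.
From mathcomp Require Import all_classical all_reals all_analysis.
From mathcomp Require Import ring lra.

Set Implicit Arguments.
Unset Strict Implicit.
Unset Printing Implicit Defensive.

Import Order.TTheory GRing.Theory Num.Theory numFieldNormedType.Exports.

Local Open Scope ring_scope.
Local Open Scope classical_set_scope.
Local Open Scope complex_scope.

(** * One-variable derivatives over a field *)

Section ComplexDerivative.
Variable K : numFieldType.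
Implicit Types (f g : K -> K) (x d : K).

(** Uniqueness rests on a real Gronwall estimate along complex segments rather than on power series.
    It serves twice: for a combination of solutions that vanishes at a point together with its
    derivative, and for a function with zero derivative. Discs are convex, so in a product of discs
    one moves along a segment in y and then along one in z. Origin of the formula for Y_k: after the
    shift by the scalar prefactor the residues are P13 + 1 and P14 + 1. Since (P13 + 1) w1 = 0 and
    (P14 + 1) w1 = sqrt 3 w2, a solution psi w1 + chi w2 must have chi = - s psi' / (sqrt 3 rho) by
    its w1 coordinate, and its w2 coordinate is then the hypergeometric equation. On discs with
    integer rho the branches are not given as rational functions, so the rationality of W cannot be
    read off its formula; hence the comparison with a rational Phi. For rho = -n the factors k + n
    and k + 3n of the recurrence never vanish, so the power series at 0 does not terminate; duality
    with rho = n replaces it. *)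

Definition hder f x d := is_derive x 1 f d.

Lemma hder_eq f x d d' : hder f x d -> d = d' -> hder f x d'.
Proof. by move=> fd <-. Qed.

Lemma hder_near f g x d : hder f x d -> (\forall t \near x, f t = g t) -> hder g x d.
Proof. by move=> fd fg; apply: near_eq_is_derive fg fd. Qed.

Lemma hder_ext f g x d : hder f x d -> f =1 g -> hder g x d.
Proof. by move=> fd /funext <-. Qed.

Lemma hder_cst c x : hder (fun=> c) x 0.
Proof. exact: is_derive_cst. Qed.

Lemma hder_id x : hder (fun t => t) x 1.
Proof. exact: is_derive_id. Qed.

Lemma hderD f g x df dg :
  hder f x df -> hder g x dg -> hder (fun t => f t + g t) x (df + dg).
Proof. exact: is_deriveD. Qed.

Lemma hderN f x df : hder f x df -> hder (fun t => - f t) x (- df).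
Proof. exact: is_deriveN. Qed.

Lemma hderB f g x df dg :
  hder f x df -> hder g x dg -> hder (fun t => f t - g t) x (df - dg).
Proof. exact: is_deriveB. Qed.

Lemma hderM f g x df dg : hder f x df -> hder g x dg ->
  hder (fun t => f t * g t) x (df * g x + f x * dg).
Proof.
move=> fd gd; apply: is_derive_eq (is_deriveM fd gd) _.
by rewrite addrC /GRing.scale /= [g x * _]mulrC.
Qed.

Lemma hderMl f x c df : hder f x df -> hder (fun t => c * f t) x (c * df).
Proof.
by move=> fd; apply: hder_eq (hderM (hder_cst c x) fd) _; rewrite mul0r add0r.
Qed.

Lemma hderMr f x c df : hder f x df -> hder (fun t => f t * c) x (df * c).
Proof.
by move=> fd; apply: hder_eq (hderM fd (hder_cst c x)) _; rewrite mulr0 addr0.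
Qed.

Lemma hderV f x df : f x != 0 -> hder f x df ->
  hder (fun t => (f t)^-1) x (- df / f x ^+ 2).
Proof.
move=> fx0 [fd <-]; apply: DeriveDef; first exact: derivableV.
by rewrite deriveV // /GRing.scale /= mulNr mulrC mulNr.
Qed.

Lemma hder_comp f g x df dg : hder f (g x) df -> hder g x dg ->
  hder (fun t => f (g t)) x (df * dg).
Proof.
move=> [fd <-] [gd <-].
have gd' := (derivable1_diffP _ _).1 gd.
have fd' := (derivable1_diffP _ _).1 fd.
have cd : differentiable (f \o g) x by exact: differentiable_comp.
apply: DeriveDef; first exact/derivable1_diffP.
have dE (h : K -> K) y v : derivable h y 1 -> 'd h y v = v * 'D_1 h y.
  by move=> hd; rewrite deriv1E // derive1E.
rewrite deriveE //.
have := congr1 (fun h => h 1) (diff_comp gd' fd') => /= ->.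
by rewrite (dE f _ _ fd) (dE g _ _ gd) mul1r mulrC.
Qed.

Lemma hder_sum n (f : 'I_n -> K -> K) x (d : 'I_n -> K) :
  (forall k, hder (f k) x (d k)) ->
  hder (fun t => \sum_k f k t) x (\sum_k d k).
Proof.
move=> fd; apply: hder_ext (is_derive_sum fd) _ => t.
by rewrite fct_sumE.
Qed.

Lemma hder_continuous f x d : hder f x d -> {for x, continuous f}.
Proof.
by move=> [fd _]; apply/differentiable_continuous/derivable1_diffP.
Qed.

Lemma hder_uniq f x d d' : hder f x d -> hder f x d' -> d = d'.
Proof. by move=> [_ <-] [_ <-]. Qed.

Lemma hderX f k x df : hder f x df ->
  hder (fun t => f t ^+ k) x (k%:R * f x ^+ k.-1 * df).
Proof.
move=> fd; elim: k => [|k IH]; first by rewrite !mul0r; exact: hder_cst.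
apply: hder_ext (hder_eq (hderM fd IH) _) _ => [|t]; last by rewrite exprS.
case: k {IH} => [|k]; first by rewrite /=; ring.
by rewrite /= [f x ^+ k.+1]exprS -[in RHS]natr1; ring.
Qed.

(** Written as a logarithmic derivative, the shape [e * pre t] in which [solmx_der] takes its
    prefactor. *)
Lemma hder_exprz f (n : int) x df : f x != 0 -> hder f x df ->
  hder (fun t => f t ^ n) x (n%:~R * (df / f x) * f x ^ n).
Proof.
move=> fx0 fd; case: n => n.
  apply: hder_eq (hderX n fd) _; case: n => [|n]; first by rewrite !mul0r.
  by rewrite /= -exprnP exprS -pmulrn; field.
rewrite NegzE.
apply: hder_ext (hder_eq (hderV _ (hderX n.+1 fd)) _) _ => [||t].
- by rewrite expf_neq0.
- change (- (n.+1%:R * f x ^+ n * df) / (f x ^+ n.+1) ^+ 2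
    = - n.+1%:R * (df / f x) / f x ^+ n.+1).
  have := expf_neq0 n fx0; rewrite (exprS (f x)); move: (f x ^+ n) => X X0.
  by field; rewrite ?fx0 ?X0.
- by rewrite -NegzE.
Qed.

(** In a [numFieldType], [0 < r] forces [r] to be real, so for complex [K] the radius is a positive
    real number seen in [K]. *)
Lemma nearP_dist (P : set K) x :
  (\forall w \near x, P w) <-> exists2 r : K, 0 < r & forall w, `|w - x| < r -> P w.
Proof.
split=> [/nbhs_ballP[r /= r0 rP]|[r r0 rP]].
  by exists r => // w wx; apply: rP; rewrite -ball_normE /= distrC.
by apply/nbhs_ballP; exists r => //= w; rewrite -ball_normE /= distrC => /rP.
Qed.

(** This increment form, free of quotients, lets real and complex derivatives be compared although
    their norms lie in different fields. *)
Lemma hderP f x d : hder f x d <-> forall e : K, 0 < e -> exists2 r : K, 0 < r &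
  forall w, `|w - x| < r -> `|f w - f x - d * (w - x)| <= e * `|w - x|.
Proof.
split=> [[/cvg_ex[l fl] <-] e e0|H].
  have -> : 'D_1 f x = l by exact: cvg_lim fl.
  have /cvgrPdist_lt/(_ e e0)/nearP_dist[r r0 rP] := fl; exists r => // w xw.
  have [->|wx] := eqVneq w x; first by rewrite !subrr mulr0 subrr !normr0 mulr0.
  have wx0 : w - x != 0 by rewrite subr_eq0.
  have := rP (w - x); rewrite subr0 => /(_ xw wx0).
  rewrite /GRing.scale /= mulr1 subrK distrC => /ltW wP.
  rewrite -[X in `|X|](_ : ((w - x)^-1 * (f w - f x) - l) * (w - x) = _).
    by rewrite normrM ler_wpM2r.
  by field.
have fl : h^-1 *: ((f \o shift x) h%:A - f x) @[h --> 0^'] --> d.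
  apply/cvgrPdist_le => e e0; have [r r0 rP] := H e e0.
  apply/nearP_dist; exists r => // h; rewrite subr0 => hr h0.
  have := rP (h + x); rewrite addrK => /(_ hr).
  rewrite /GRing.scale /= mulr1 -ler_pdivrMr ?normr_gt0 // -normf_div.
  rewrite distrC => rh; rewrite -[X in `|X|](_ : (f (h + x) - f x - d * h) / h = _) //.
  by field.
by apply: DeriveDef; [apply/cvg_ex; exists d|exact: cvg_lim fl].
Qed.
End ComplexDerivative.

(** * Complex exponential and restriction to real segments *)

Section Cexp.
Variable R : realType.
Notation C := (Cx R).
Notation hderC := (@hder (R[i] : numFieldType)).

Lemma normC_Re (z : R[i]) : `|complex.Re z|%:C <= `|z|.
Proof.
rewrite normc_def lecR; case: z => a b /=.
by rewrite -sqrtr_sqr ler_wsqrtr // lerDl sqr_ge0.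
Qed.

Lemma normC_Im (z : R[i]) : `|complex.Im z|%:C <= `|z|.
Proof.
rewrite normc_def lecR; case: z => a b /=.
by rewrite -sqrtr_sqr ler_wsqrtr // lerDr sqr_ge0.
Qed.

Lemma normC_le (z : R[i]) : `|z| <= (`|complex.Re z| + `|complex.Im z|)%:C.
Proof.
rewrite normc_def lecR; case: z => a b /=.
rewrite -[leRHS]ger0_norm ?addr_ge0// -[leRHS]sqrtr_sqr ler_wsqrtr//.
rewrite sqrrD !real_normK ?num_real// lerD2r lerDl mulrn_wge0// mulr_ge0//.
Qed.

Lemma posC (e : R[i]) : 0 < e -> e = (complex.Re e)%:C /\ 0 < complex.Re e.
Proof. by case: e => a b; rewrite ltcE /= => /andP[/eqP -> ->]. Qed.

Lemma cexpD (z w : C) : cexp (z + w) = cexp z * cexp w.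
Proof.
case: z w => [a b] [c d]; rewrite /cexp /=.
by apply/eqP; rewrite eq_complex /= expRD cosD sinD; apply/andP; split; apply/eqP; ring.
Qed.

Lemma cexp0 : cexp 0 = 1 :> C.
Proof. by rewrite /cexp /= expR0 cos0 sin0 mulr1 mulr0. Qed.

(** Real form of the bound on [cexp w - 1 - w] for w = x + iy. The two decompositions in the proof
    separate the errors of [expR], [cos] and [sin] at 0; together they contribute at most k|x| +
    7k|y|, whence the 8. *)
Lemma cexp_err (x y k : R) : k <= 1 -> `|x| <= k ->
  `|expR x - 1 - x| <= k * `|x| -> `|cos y - 1| <= k * `|y| ->
  `|sin y - y| <= k * `|y| ->
  `|expR x * cos y - 1 - x| + `|expR x * sin y - 0 - y| <= 8 * k * (`|x| + `|y|).
Proof.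
move=> k1 xk; have := cos_max y.
have := normr_ge0 x; have := normr_ge0 y.
set E := expR x - 1 - x; set c := cos y; set s := sin y.
move=> x0 y0 c1 EP cP sP.
have k0 : 0 <= k by exact: le_trans xk.
rewrite [X in `|X| + _](_ : _ = E * c + (1 + x) * (c - 1)); last by rewrite /E; ring.
rewrite [X in _ + `|X|](_ : _ = (1 + x + E) * (s - y) + (x + E) * y); last by rewrite /E; ring.
have x1 : `|1 + x| <= 2 by apply: le_trans (ler_normD _ _) _; rewrite normr1; lra.
have xE : `|x + E| <= 2 * k by apply: le_trans (ler_normD _ _) _; nra.
have xE1 : `|1 + x + E| <= 3.
  by rewrite -addrA; apply: le_trans (ler_normD _ _) _; rewrite normr1; lra.
have h1 : `|E * c| <= k * `|x| by rewrite normrM; apply: le_trans EP; rewrite ler_piMr.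
have h2 : `|(1 + x) * (c - 1)| <= 2 * (k * `|y|) by rewrite normrM ler_pM.
have h3 : `|(1 + x + E) * (s - y)| <= 3 * (k * `|y|) by rewrite normrM ler_pM.
have h4 : `|(x + E) * y| <= 2 * k * `|y| by rewrite normrM ler_wpM2r.
have := ler_normD (E * c) ((1 + x) * (c - 1)).
have := ler_normD ((1 + x + E) * (s - y)) ((x + E) * y).
nra.
Qed.

Lemma hder_cexp0 : hderC (@cexp R) (0 : R[i]) 1.
Proof.
apply/hderP => e /posC[-> e0]; set r := complex.Re e in e0 *.
(* With k at most r / 16, the bound 8 k (|x| + |y|) is at most (r / 2)(|x| + |y|), and |x| + |y| is
   at most 2 |w|. *)
have r0 : 0 < Num.min (r / 16) 1 by rewrite lt_min ltr01 divr_gt0.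
set k := Num.min (r / 16) 1 in r0.
have kr : k <= r / 16 by rewrite ge_min lexx.
have k1 : k <= 1 by rewrite ge_min lexx orbT.
move: k r0 kr k1 => k r0 kr k1.
have /hderP/(_ k r0)[d1 d10 exp_near] : hder expR (0 : R) 1.
  by apply: hder_eq (is_derive_expR 0) _; rewrite expR0.
have /hderP/(_ k r0)[d2 d20 cos_near] : hder cos (0 : R) 0.
  by apply: hder_eq (is_derive_cos 0) _; rewrite sin0 oppr0.
have /hderP/(_ k r0)[d3 d30 sin_near] : hder sin (0 : R) 1.
  by apply: hder_eq (is_derive_sin 0) _; rewrite cos0.
pose d := Num.min (Num.min d1 d2) (Num.min d3 k).
have d0 : 0 < d by rewrite !lt_min d10 d20 d30 r0.
exists d%:C; first by rewrite /= ltcR.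
move=> w; rewrite subr0 => wd.
have := lt_le_trans (le_lt_trans (normC_Re w) wd) (lexx _).
have := lt_le_trans (le_lt_trans (normC_Im w) wd) (lexx _).
rewrite !ltcR !lt_min => /andP[/andP[y1 y2] /andP[y3 y4]] /andP[/andP[x1 x2] /andP[x3 x4]].
move: (exp_near (complex.Re w)) (cos_near (complex.Im w)) (sin_near (complex.Im w)).
rewrite !subr0 expR0 cos0 sin0 mul0r !mul1r !subr0.
move=> /(_ x1) expP /(_ y2) cosP /(_ y3) sinP.
rewrite cexp0.
have wle : (`|complex.Re w| + `|complex.Im w|)%:C <= 2 * `|w|.
  by rewrite rmorphD /= mulr_natl mulr2n lerD ?normC_Re ?normC_Im.
apply: le_trans (normC_le _) _.
apply: (@le_trans _ _ ((`|complex.Re w| + `|complex.Im w|) * (r / 2))%:C); last first.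
  rewrite rmorphM /= [X in _ <= X](_ : _ = 2 * `|w| * (r / 2)%:C).
    by rewrite ler_wpM2r // lecR divr_ge0 // ltW.
  by rewrite rmorphM /= fmorphV rmorph_nat; field.
rewrite lecR.
case: w {wle wd} x1 x2 x3 x4 y1 y2 y3 y4 expP cosP sinP => x y /=.
rewrite /cexp /= => _ _ _ xk _ _ _ yk expP cosP sinP.
apply: le_trans (cexp_err k1 (ltW xk) expP cosP sinP) _.
by have := normr_ge0 x; have := normr_ge0 y; nra.
Qed.

(** The functional equation transports the derivative at 0 to every point. *)
Lemma hder_cexp (z : C) : hderC (@cexp R) (z : R[i]) (cexp z).
Proof.
have h1 : hderC (fun t : R[i] => t - z) z 1.
  by apply: hder_eq (hderB (hder_id _) (hder_cst _ _)) _; rewrite subr0.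
have h2 : hderC (@cexp R) (z - z : R[i]) 1 by rewrite subrr; exact: hder_cexp0.
apply: (hder_ext (f := fun t : R[i] => cexp z * cexp (t - z))) => [|t].
  have h3 := @hder_comp R[i] (@cexp R) (fun t => t - z) z _ _ h2 h1.
  have h4 := @hderMl R[i] _ z (cexp z) _ h3.
  apply: hder_eq h4 _.
  by rewrite !mulr1.
by rewrite -cexpD addrC subrK.
Qed.

Lemma cexp_neq0 (z : C) : cexp z != 0.
Proof.
apply/eqP => z0; have := @cexp0; rewrite -(subrr z) cexpD z0 mul0r => /eqP.
by rewrite eq_sym oner_eq0.
Qed.

(** Bridge from complex to real analysis: restricted to a segment, a complex derivative becomes a
    real one with the direction [q] as a factor. *)
Lemma hder_Re_path (f : R[i] -> R[i]) (p q : R[i]) (t : R) d :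
  hderC f (p + t%:C * q) d ->
  hder (fun u : R => complex.Re (f (p + u%:C * q))) t (complex.Re (d * q)).
Proof.
move=> /hderP fd; apply/hderP => e e0.
(* Dividing by |q| + 1 instead of |q| keeps the case [q = 0] legitimate. *)
have q0 : 0 < `|q| + 1 by rewrite ltr_wpDl.
have [n qR0 qE] : exists2 n : R, 0 < n & `|q| + 1 = n%:C.
  by have [? ?] := posC q0; exists (complex.Re (`|q| + 1)).
have e1 : 0 < (e / n)%:C by rewrite ltcR divr_gt0.
have [r' /posC[-> r0] rP] := fd _ e1; set r := complex.Re r' in r0 rP.
exists (r / n); first exact: divr_gt0.
move=> u; rewrite ltr_pdivlMr // => ut.
have uq : `|(u - t)%:C * q| <= (`|u - t| * n)%:C.
  rewrite normrM normc_def /= expr0n /= addr0 sqrtr_sqr rmorphM /=.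
  apply: ler_wpM2l; first by rewrite lecR.
  by rewrite -qE lerDl.
have ptE : p + u%:C * q - (p + t%:C * q) = (u - t)%:C * q.
  by rewrite rmorphB /=; ring.
have := rP (p + u%:C * q); rewrite ptE.
move=> /(_ (le_lt_trans uq _)); rewrite ltcR => /(_ ut) fP.
rewrite -lecR; apply: le_trans (le_trans fP _).
- have aux (A B D E : R[i]) (v : R) : complex.Re A - complex.Re B -
    complex.Re (D * E) * v = complex.Re (A - B - D * (v%:C * E)).
    by case: A B D E => [? ?] [? ?] [? ?] [? ?] /=; ring.
  by rewrite aux; exact: normC_Re.
- apply: (@le_trans _ _ ((e / n)%:C * (`|u - t| * n)%:C)).
    by apply: ler_wpM2l; [exact: ltW|exact: uq].
  rewrite -rmorphM lecR /=.
  by have -> : e / n * (`|u - t| * n) = e * `|u - t| by field; rewrite gt_eqF.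
Qed.

End Cexp.

(** * Uniqueness for linear systems *)

Section Uniqueness.
Variable R : realType.
Notation C := (Cx R).
Notation hderC := (@hder (R[i] : numFieldType)).

(** [N t * expR (- K * t)] has a nonpositive derivative, so it does not increase from its value
    0. *)
Lemma gronwall0 (N dN : R -> R) (K : R) :
  (forall t, 0 <= t <= 1 -> hder N t (dN t)) ->
  (forall t, 0 <= t <= 1 -> dN t <= K * N t) ->
  N 0 = 0 -> N 1 <= 0.
Proof.
move=> Nd NK N0.
pose E t := N t * expR (- K * t).
have Ed t : 0 <= t <= 1 ->
    hder E t ((dN t - K * N t) * expR (- K * t)).
  move=> t01; have h1 := hderMl (- K) (hder_id t).
  have h2 : hder expR (- K * t) (expR (- K * t)) by exact: is_derive_expR.
  by apply: hder_eq (hderM (Nd t t01) (hder_comp h2 h1)) _; ring.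
have E0 : E 0 = 0 by rewrite /E N0 mul0r.
suff : E 1 <= E 0 by rewrite E0 /E pmulr_lle0 ?expR_gt0.
have oo t : t \in `]0, 1[%R -> 0 <= t <= 1.
  by rewrite in_itv /= => /andP[/ltW -> /ltW ->].
apply: (@ler0_derive1_le_cc _ E 0 1); rewrite ?in_itv /= ?lexx ?ler01 //.
- by move=> t /oo /Ed [].
- move=> t /oo t01; have [_] := Ed t t01; rewrite derive1E => ->.
  by rewrite mulr_le0_ge0 ?expR_ge0 // subr_le0 NK.
- apply: derivable_within_continuous => t; rewrite in_itv /= => t01.
  by case: (Ed t t01).
Qed.

Lemma hder_Im_path (f : R[i] -> R[i]) (p q : R[i]) (t : R) d :
  hderC f (p + t%:C * q) d ->
  hder (fun u : R => complex.Im (f (p + u%:C * q))) t (complex.Im (d * q)).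
Proof.
move=> fd.
have ImE (z : R[i]) : complex.Im z = complex.Re ((0 -i* 1) * z) by case: z => a b /=; ring.
apply: hder_ext (hder_eq (hder_Re_path (hderMl (0 -i* 1) fd)) _) _ => [|u].
  by rewrite -mulrA -ImE.
by rewrite -ImE.
Qed.

(** The square is used because the modulus itself is not differentiable at zeros. *)
Definition sqmod (z : R[i]) : R := complex.Re z ^+ 2 + complex.Im z ^+ 2.

Lemma sqmod_ge0 z : 0 <= sqmod z.
Proof. by rewrite addr_ge0 ?sqr_ge0. Qed.

Lemma sqmod_eq0 z : sqmod z <= 0 -> z = 0.
Proof.
case: z => a b; rewrite /sqmod /= => ab; apply/eqP; rewrite eq_complex /=.
have := sqr_ge0 a; have := sqr_ge0 b => b0 a0.
by rewrite -(sqrf_eq0 a) -(sqrf_eq0 b); apply/andP; split; apply/eqP; lra.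
Qed.

(** The left side is the derivative of |f|^2 when [h] is that of [f]. By Cauchy-Schwarz it is at
    most 2|f||h|, hence at most 2M(|f|^2 + |f||g|), and 2|f||g| is at most |f|^2 + |g|^2; this gives
    the constant 3. *)
Lemma sqmod_der_le (f g h : R[i]) (M : R) : 0 <= M ->
  `|h| <= M%:C * (`|f| + `|g|) ->
  2 * (complex.Re f * complex.Re h + complex.Im f * complex.Im h)
    <= 3 * M * (sqmod f + sqmod g).
Proof.
move=> M0; rewrite !normc_def -rmorphD -rmorphM lecR.
case: f g h => [a b] [c d] [x y]; rewrite /sqmod /=.
have s_ge0 (u v : R) : 0 <= u ^+ 2 + v ^+ 2 by rewrite addr_ge0 ?sqr_ge0.
have := sqrtr_ge0 (x ^+ 2 + y ^+ 2); have := sqr_sqrtr (s_ge0 x y).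
have := sqrtr_ge0 (a ^+ 2 + b ^+ 2); have := sqr_sqrtr (s_ge0 a b).
have := sqrtr_ge0 (c ^+ 2 + d ^+ 2); have := sqr_sqrtr (s_ge0 c d).
move: (Num.sqrt (c ^+ 2 + d ^+ 2)) (Num.sqrt (a ^+ 2 + b ^+ 2)) (Num.sqrt (x ^+ 2 + y ^+ 2)).
move=> G F H G2 G0 F2 F0 H2 H0 HM.
have CS : a * x + b * y <= F * H.
  case: (lerP (a * x + b * y) 0) => [/le_trans|/ltW] P0.
    by apply: P0; exact: mulr_ge0.
  rewrite -(@ler_pXn2r _ 2) ?nnegrE ?mulr_ge0 // exprMn F2 H2.
  by have := sqr_ge0 (a * y - b * x); nra.
have : F * H <= F * (M * (F + G)) by rewrite ler_wpM2l.
have : 0 <= M * (F - G) ^+ 2 by rewrite mulr_ge0 ?sqr_ge0.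
have : 0 <= M * G ^+ 2 by rewrite mulr_ge0 ?sqr_ge0.
rewrite -F2 -G2; nra.
Qed.

Definition diffC (f : R[i] -> R[i]) (x : R[i]) := exists d, hderC f x d.

(** Differentiability makes the squared modulus continuous on the compact interval, where it attains
    a maximum. *)
Lemma path_bound (f : R[i] -> R[i]) (p q : R[i]) :
  (forall t : R, 0 <= t <= 1 -> diffC f (p + t%:C * q)) ->
  exists2 M : R, 0 <= M & forall t : R, 0 <= t <= 1 -> `|f (p + t%:C * q)| <= M%:C.
Proof.
move=> fd.
pose u t := (complex.Re (f (p + t%:C * q))) ^+ 2 + (complex.Im (f (p + t%:C * q))) ^+ 2.
have ucont : {within `[0, 1], continuous u}.
  apply: derivable_within_continuous => t; rewrite in_itv /= => /fd[d fd'].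
  by have [] := hderD (hderX 2 (hder_Re_path fd')) (hderX 2 (hder_Im_path fd')).
have [c c01 cmax] := EVT_max ler01 ucont.
exists (Num.sqrt (u c)); first exact: sqrtr_ge0.
move=> t t01; rewrite normc_def lecR ler_wsqrtr //.
have := cmax t; rewrite in_itv /= => /(_ t01); rewrite /u.
by case: (f _).
Qed.

(* Gronwall for |f|^2 + |g|^2 along the segment from p to p + q. *)
Lemma linear_system_uniq (f g al be ga : R[i] -> R[i]) (p q : R[i]) :
  (forall t : R, 0 <= t <= 1 -> let x := p + t%:C * q in
     [/\ hderC f x (al x * g x), hderC g x (be x * f x + ga x * g x),
         diffC al x, diffC be x & diffC ga x]) ->
  f p = 0 -> g p = 0 -> f (p + q) = 0 /\ g (p + q) = 0.
Proof.
move=> H fp gp.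
have [A A0 AP] : exists2 M : R, 0 <= M &
    forall t : R, 0 <= t <= 1 -> `|al (p + t%:C * q)| <= M%:C.
  by apply: path_bound => t /H[].
have [B B0 BP] : exists2 M : R, 0 <= M &
    forall t : R, 0 <= t <= 1 -> `|be (p + t%:C * q)| <= M%:C.
  by apply: path_bound => t /H[].
have [G G0 GP] : exists2 M : R, 0 <= M &
    forall t : R, 0 <= t <= 1 -> `|ga (p + t%:C * q)| <= M%:C.
  by apply: path_bound => t /H[].
have [Q Q0 QE] : exists2 M : R, 0 <= M & `|q| = M%:C.
  by rewrite normc_def; exists (Num.sqrt (complex.Re q ^+ 2 + complex.Im q ^+ 2));
    rewrite ?sqrtr_ge0.
(* [A + B + G] dominates each coefficient, and [Q] is the speed of the path from p to p + q. *)
pose M := (A + B + G) * Q.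
have M0 : 0 <= M by rewrite mulr_ge0 // !addr_ge0.
pose P (t : R) := p + t%:C * q.
pose N (t : R) := sqmod (f (P t)) + sqmod (g (P t)).
pose df t := al (P t) * g (P t) * q.
pose dg t := (be (P t) * f (P t) + ga (P t) * g (P t)) * q.
pose dN (t : R) :=
  2 * (complex.Re (f (P t)) * complex.Re (df t) + complex.Im (f (P t)) * complex.Im (df t)) +
  2 * (complex.Re (g (P t)) * complex.Re (dg t) + complex.Im (g (P t)) * complex.Im (dg t)).
suff : N 1 <= 0.
  rewrite /N /P mul1r => N1.
  have := sqmod_ge0 (f (p + q)); have := sqmod_ge0 (g (p + q)) => g1 f1.
  by split; apply: sqmod_eq0; lra.
(* [sqmod_der_le] contributes 3 M once for [f] and once for [g]. *)
apply: (@gronwall0 N dN (6 * M)).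
- move=> t /H[fd gd _ _ _].
  have sq (h : R[i] -> R[i]) d : hderC h (P t) d -> hder (fun u => sqmod (h (P u))) t
      (2 * (complex.Re (h (P t)) * complex.Re (d * q)
            + complex.Im (h (P t)) * complex.Im (d * q))).
    move=> hd.
    apply: hder_eq (hderD (hderX 2 (hder_Re_path hd)) (hderX 2 (hder_Im_path hd))) _.
    by rewrite /= /P; ring.
  exact: hderD (sq _ _ fd) (sq _ _ gd).
- move=> t t01; have := AP t t01; have := BP t t01; have := GP t t01; rewrite -/(P t).
  move=> Gt Bt At.
  have ne (z : R[i]) : 0 <= `|z| by [].
  have f1 : `|df t| <= M%:C * (`|f (P t)| + `|g (P t)|).
    rewrite /df !normrM QE mulrAC /M rmorphM /=.
    rewrite [leRHS](_ : _ = (A + B + G)%:C * Q%:C * `|g (P t)|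
      + (A + B + G)%:C * Q%:C * `|f (P t)|); last by ring.
    apply: ler_wpDr; first by rewrite mulr_ge0 // mulr_ge0 // lecR // !addr_ge0.
    apply: ler_wpM2r => //; apply: ler_wpM2r; first by rewrite lecR.
    by apply: le_trans At _; rewrite lecR; lra.
  have g1 : `|dg t| <= M%:C * (`|g (P t)| + `|f (P t)|).
    rewrite /dg normrM QE /M rmorphM /= mulrAC; apply: ler_wpM2r; first by rewrite lecR.
    apply: le_trans (ler_normD _ _) _; rewrite addrC mulrDr !normrM.
    apply: lerD; apply: ler_wpM2r => //;
      [apply: le_trans Gt _|apply: le_trans Bt _]; rewrite lecR; lra.
  have := sqmod_der_le M0 f1; have := sqmod_der_le M0 g1.
  by rewrite /dN /N; lra.
- by rewrite /N /P mul0r addr0 fp gp /sqmod /= expr0n /= !addr0.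
Qed.
End Uniqueness.

(** * Derivatives of matrix functions *)

Section MatrixDerivative.
Variable K : numFieldType.

(** Entrywise, matching the way [kz_fundamental_on] states the derivatives. *)
Definition mxder m n (M : K -> 'M[K]_(m, n)) (t : K) (D : 'M[K]_(m, n)) :=
  forall i j, hder (fun u => M u i j) t (D i j).

Lemma mxder_eq m n (M : K -> 'M[K]_(m, n)) t D D' :
  mxder M t D -> D = D' -> mxder M t D'.
Proof. by move=> MD <-. Qed.

Lemma mxder_cst m n (A : 'M[K]_(m, n)) t : mxder (fun=> A) t 0.
Proof. by move=> i j; rewrite mxE; exact: hder_cst. Qed.

Lemma mxderM m n p (M : K -> 'M[K]_(m, n)) (N : K -> 'M[K]_(n, p)) t D E :
  mxder M t D -> mxder N t E ->
  mxder (fun u => M u *m N u) t (D *m N t + M t *m E).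
Proof.
move=> MD NE i j; have h := hder_sum (fun k => hderM (MD i k) (NE k j)).
apply: hder_ext (hder_eq h _) _ => [|u].
  by rewrite mxE [in RHS]mxE [in RHS]mxE -big_split.
by rewrite mxE.
Qed.

Lemma mxder_tr m n (M : K -> 'M[K]_(m, n)) t D :
  mxder M t D -> mxder (fun u => (M u)^T) t D^T.
Proof.
move=> MD i j; apply: hder_ext (hder_eq (MD j i) _) _ => [|u]; by rewrite mxE.
Qed.

Lemma hder_near_neq0 (f : K -> K) t d : hder f t d -> f t != 0 ->
  \forall u \near t, f u != 0.
Proof. by move=> /hder_continuous fc f0; exact: (cvgr_neq0 _ fc). Qed.

Lemma det2 (M : 'M[K]_2) : \det M = M 0 0 * M 1 1 - M 0 1 * M 1 0.
Proof.
rewrite (expand_det_row _ 0) big_ord_recl big_ord1 /cofactor !det_mx11 !mxE /=.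
rewrite !addn0 expr0 mul1r /bump /= expr1 mulN1r mulrN.
by congr (_ * M _ _ - M _ _ * M _ _); apply: val_inj.
Qed.

(** In ['I_2] the index [1 - i] is the other one, so this is the adjugate formula. *)
Lemma invmx2 (M : 'M[K]_2) i j : \det M != 0 ->
  invmx M i j = (\det M)^-1 * (if i == j then M (1 - i) (1 - j) else - M i j).
Proof.
move=> M0.
suff -> : invmx M = \matrix_(i, j)
    ((\det M)^-1 * (if i == j then M (1 - i) (1 - j) else - M i j)) by rewrite mxE.
have Mu : M \in unitmx by rewrite unitmxE unitfE.
apply: (can_inj (mulKmx Mu)); rewrite mulmxV //.
apply/matrixP => k l; rewrite !mxE big_ord_recl big_ord1 !mxE.
move: M0; rewrite det2 => M0.
have k2 (k' : 'I_2) : k' = 0 \/ k' = 1.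
  by case: k' => [[|[|//]] ?]; [left|right]; apply: val_inj.
have e1 : lift 0 0 = 1 :> 'I_2 by apply: val_inj.
have e2 : 1 - 1 = 0 :> 'I_2 by apply: val_inj.
have e3 : 1 - 0 = 1 :> 'I_2 by apply: val_inj.
case: (k2 k) => ->; case: (k2 l) => ->; rewrite ?e1 ?e2 ?e3 /= ?e2 ?e3; field; exact: M0.
Qed.

(** The adjugate formula yields only the existence of the derivative; its value comes from
    differentiating the identity M M^-1 = 1. *)
Lemma mxderV (M : K -> 'M[K]_2) t D : M t \in unitmx -> mxder M t D ->
  mxder (fun u => invmx (M u)) t (- (invmx (M t) *m D *m invmx (M t))).
Proof.
move=> Mt MD.
have dt0 : \det (M t) != 0 by rewrite -unitfE -unitmxE.
have [dd detd] : exists d, hder (fun u => \det (M u)) t d.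
  eexists; apply: hder_ext (hderB (hderM (MD 0 0) (MD 1 1)) (hderM (MD 0 1) (MD 1 0))) _ => u.
  by rewrite det2.
have near0 : \forall u \near t, \det (M u) != 0 by exact: hder_near_neq0 detd dt0.
have [E ME] : exists E, mxder (fun u => invmx (M u)) t E.
  have [e eP] : exists e : 'I_2 -> 'I_2 -> K, forall i j,
      hder (fun u => invmx (M u) i j) t (e i j).
    have ex i j : exists e, hder (fun u => invmx (M u) i j) t e.
      have [d' d'P] : exists d',
          hder (fun u => if i == j then M u (1 - i) (1 - j) else - M u i j) t d'.
        case: (i == j); first by exists (D (1 - i) (1 - j)); exact: MD.
        by exists (- D i j); exact: hderN.
      have h := hderM (hderV dt0 detd) d'P; eexists; apply: (hder_near h).
      by near=> u; rewrite invmx2 //; near: u.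
    exists (fun i j => projT1 (cid (ex i j))) => i j; exact: projT2 (cid (ex i j)).
  by exists (\matrix_(i, j) e i j) => i j; rewrite mxE.
suff -> : - (invmx (M t) *m D *m invmx (M t)) = E by [].
have H : D *m invmx (M t) + M t *m E = 0.
  apply/matrixP => i j; rewrite [RHS]mxE.
  apply: hder_uniq (mxderM MD ME i j) _.
  apply: hder_near (hder_cst ((1%:M : 'M[K]_2) i j) t) _.
  near=> u; rewrite mulmxV //; rewrite unitmxE unitfE; near: u.
  exact: near0.
rewrite -[E](mulKmx Mt) -mulmxA -mulmxN; congr (_ *m _).
by apply/eqP; rewrite eq_sym -addr_eq0 addrC H.
Unshelve. all: by end_near. Qed.

End MatrixDerivative.

(** * The connection matrices and the KZ system *)

Section Connection.
Variables (K : numFieldType) (r3 rho : K).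
Hypotheses (r3E : r3 ^+ 2 = 3) (rho0 : rho != 0).

(* [psi''] in terms of [psi] and [psi'], from the hypergeometric equation. *)
Definition gauss2 (v f f' : K) : K :=
  (3 * rho ^+ 2 * f - (1 - 2 * rho - (1 - 4 * rho) * v) * f') / (v * (1 - v)).

(** [F'] stands for psi' composed with the curve [u], not for the derivative of [F]; this is why
    [du] appears in both derivatives. *)
Definition solves_along (F F' u : K -> K) (t du : K) :=
  [/\ hder u t du, hder F t (F' t * du) & hder F' t (gauss2 (u t) (F t) (F' t) * du)].

Definition solvec (x1 x2 : 'cV[K]_2) (pre F F' u : K) : 'cV[K]_2 :=
  pre *: (F *: x1 - (u / (r3 * rho) * F') *: x2).

(* The four eigenvector relations hold for P13, P14 on w1, w2 and for P12, P13 on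
   v1, - v2, so that W1 and W2 are both instances. *)
Lemma solvec_der (A B : 'M[K]_2) (x1 x2 : 'cV[K]_2) (pre F F' u : K -> K) t du e :
  A *m x1 = - x1 -> B *m x1 = r3 *: x2 - x1 ->
  A *m x2 = x2 - r3 *: x1 -> B *m x2 = x2 ->
  u t != 0 -> u t - 1 != 0 ->
  hder pre t (e * pre t) -> solves_along F F' u t du ->
  mxder (fun v => solvec x1 x2 (pre v) (F v) (F' v) (u v)) t
    ((rho *: ((du / u t) *: (A + 1%:M) + (du / (u t - 1)) *: (B + 1%:M)) + e%:M)
       *m solvec x1 x2 (pre t) (F t) (F' t) (u t)).
Proof.
move=> A1 B1 A2 B2 u0 u1 pred [ud Fd F'd] i j.
have r30 : r3 != 0 by rewrite -sqrf_eq0 r3E pnatr_eq0.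
have h : hder (fun v => pre v * (F v * x1 i j - u v / (r3 * rho) * F' v * x2 i j)) t
  (e * pre t * (F t * x1 i j - u t / (r3 * rho) * F' t * x2 i j)
   + pre t * (F' t * du * x1 i j - (du / (r3 * rho) * F' t
       + u t / (r3 * rho) * (gauss2 (u t) (F t) (F' t) * du)) * x2 i j)).
  exact: hderM pred (hderB (hderMr _ Fd) (hderMr _ (hderM (hderMr _ ud) F'd))).
apply: hder_ext (hder_eq h _) _ => [|v]; last by rewrite /solvec !mxE.
have E1 M N : (rho *: ((du / u t) *: (M + 1%:M) + (du / (u t - 1)) *: (N + 1%:M)) + e%:M) *m x1
  = rho *: ((du / u t) *: (M *m x1 + x1) + (du / (u t - 1)) *: (N *m x1 + x1)) + e *: x1.
  by rewrite mulmxDl -!scalemxAl mulmxDl -!scalemxAl !mulmxDl !mul1mx mul_scalar_mx.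
have E2 M N : (rho *: ((du / u t) *: (M + 1%:M) + (du / (u t - 1)) *: (N + 1%:M)) + e%:M) *m x2
  = rho *: ((du / u t) *: (M *m x2 + x2) + (du / (u t - 1)) *: (N *m x2 + x2)) + e *: x2.
  by rewrite mulmxDl -!scalemxAl mulmxDl -!scalemxAl !mulmxDl !mul1mx mul_scalar_mx.
rewrite /solvec -scalemxAr mulmxBr -!scalemxAr E1 E2 A1 B1 A2 B2 !mxE /gauss2.
(* Once the inverse is removed, the only relation that [field] needs is r3 * r3 = 3. *)
have r3i : r3^-1 = r3 / 3 by rewrite -r3E; field.
have u1' : 1 - u t != 0 by rewrite -opprB oppr_eq0.
rewrite !invfM r3i.
have r33 : r3 * r3 = 3 by rewrite -expr2.
move: (F t) (F' t) (u t) (pre t) (x1 i j) (x2 i j) u0 u1 u1' => f f' v p a b v0 v1 v1'.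
(* This is an identity in the two vector entries [a] and [b]: the coefficients of [a] agree by the
   choice of the factor u / (r3 rho), those of [b] by the hypergeometric equation already solved in
   [gauss2]. *)
field: r33.
by rewrite v0 v1 v1' rho0.
Qed.

Definition solmx (x1 x2 : 'cV[K]_2) (pre : K) (F F' : 'I_2 -> K) (u : K) : 'M[K]_2 :=
  \matrix_(i, k) solvec x1 x2 pre (F k) (F' k) u i 0.

Lemma solmx_der (A B : 'M[K]_2) (x1 x2 : 'cV[K]_2) (pre u : K -> K)
    (F F' : 'I_2 -> K -> K) t du e :
  A *m x1 = - x1 -> B *m x1 = r3 *: x2 - x1 ->
  A *m x2 = x2 - r3 *: x1 -> B *m x2 = x2 ->
  u t != 0 -> u t - 1 != 0 ->
  hder pre t (e * pre t) -> (forall k, solves_along (F k) (F' k) u t du) ->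
  mxder (fun v => solmx x1 x2 (pre v) (F^~ v) (F'^~ v) (u v)) t
    ((rho *: ((du / u t) *: (A + 1%:M) + (du / (u t - 1)) *: (B + 1%:M)) + e%:M)
       *m solmx x1 x2 (pre t) (F^~ t) (F'^~ t) (u t)).
Proof.
move=> A1 B1 A2 B2 u0 u1 pred Fs i k.
apply: hder_ext (hder_eq (solvec_der A1 B1 A2 B2 u0 u1 pred (Fs k) i 0) _) _ => [|v].
  by rewrite [LHS]mxE [RHS]mxE; apply: eq_bigr => l _; rewrite [solmx _ _ _ _ _ _ l k]mxE.
by rewrite [RHS]mxE.
Qed.

(** The matrix is [x1, x2] times the matrix of the F k and the multiples of F' k, up to the scalar
    [pre]; determinants multiply, so invertibility reduces to the Wronskian. *)
Lemma det_solmx x1 x2 pre F F' u : \det (solmx x1 x2 pre F F' u) =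
  - (pre ^+ 2 * (u / (r3 * rho)) * (F 0 * F' 1 - F 1 * F' 0)
     * (x1 0 0 * x2 1 0 - x1 1 0 * x2 0 0)).
Proof. by rewrite det2 !mxE; move: (u / _) => q; ring. Qed.

End Connection.

Section KZ.
Variables (R : realType) (rho : R[i]).
Hypothesis rho0 : rho != 0.
Notation C := (Cx R).
Notation hderC := (@hder (R[i] : numFieldType)).
Let r3 : R[i] := sqrt3 R.

Lemma sqrt3E : r3 ^+ 2 = 3.
Proof. by rewrite /r3 /sqrt3 -rmorphXn /= sqr_sqrtr ?ler0n // rmorph_nat. Qed.

Lemma sqrt3_neq0 : r3 != 0.
Proof. by rewrite -sqrf_eq0 sqrt3E pnatr_eq0. Qed.

Lemma ord2P (P : 'I_2 -> Prop) : P 0 -> P 1 -> forall i, P i.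
Proof.
move=> P0 P1 [[|[|//]] i].
  by have -> : Ordinal i = 0 by exact: val_inj.
by have -> : Ordinal i = 1 by exact: val_inj.
Qed.

Let cV2P (x y : 'cV[R[i]]_2) : x 0 0 = y 0 0 -> x 1 0 = y 1 0 -> x = y.
Proof. by move=> h0 h1; apply/colP => i; move: i; apply: ord2P. Qed.

Let mulcV (M : 'M[R[i]]_2) (x : 'cV[R[i]]_2) i :
  (M *m x) i 0 = M i 0 * x 0 0 + M i 1 * x 1 0.
Proof.
rewrite mxE big_ord_recl big_ord1; congr (_ + M _ _ * x _ _); exact: val_inj.
Qed.

Ltac col_tac := apply: cV2P; rewrite ?mulcV !mxE /=; rewrite /r3;
  by field: (sqrt3E : sqrt3 R ^+ 2 = 3).

Lemma P13w1 : P13 R *m w1 R = - w1 R. Proof. col_tac. Qed.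
Lemma P14w1 : P14 R *m w1 R = r3 *: w2 R - w1 R. Proof. col_tac. Qed.
Lemma P13w2 : P13 R *m w2 R = w2 R - r3 *: w1 R. Proof. col_tac. Qed.
Lemma P14w2 : P14 R *m w2 R = w2 R. Proof. col_tac. Qed.
Lemma P12v1 : P12 R *m v1 R = - v1 R. Proof. col_tac. Qed.
Lemma P13v1 : P13 R *m v1 R = r3 *: - v2 R - v1 R. Proof. col_tac. Qed.
Lemma P12v2 : P12 R *m - v2 R = - v2 R - r3 *: v1 R. Proof. col_tac. Qed.
Lemma P13v2 : P13 R *m - v2 R = - v2 R. Proof. col_tac. Qed.
(** Conceptually, the three reflections form a conjugacy class, so their sum is scalar by Schur; its
    trace is 0. *)
Lemma P_sum : P12 R = - (P13 R + P14 R).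
Proof. by apply/matrixP; apply: ord2P; apply: ord2P; rewrite !mxE /=; field. Qed.

(** The scalar is the logarithmic derivative of the prefactor; it undoes the shift of both residues
    by the identity. *)
Lemma shift_connection (A B : 'M[R[i]]_2) (al be : R[i]) :
  rho *: (al *: (A + 1%:M) + be *: (B + 1%:M)) + (- rho * (al + be))%:M
  = rho *: (al *: A + be *: B).
Proof.
apply/matrixP => i j; rewrite !mxE.
by case: (i == j); rewrite ?mulr1n ?mulr0n; ring.
Qed.

(* The derivative of [A *m invmx B *m E]: the scalar [e] commutes with everything
   and cancels. *)
Lemma gauge_cancel (A B E Z Z0 : 'M[R[i]]_2) (e : R[i]) : B \in unitmx ->
  ((Z + e%:M) *m A *m invmx B
     + A *m - (invmx B *m ((Z0 + e%:M) *m B) *m invmx B)) *m E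
   + A *m invmx B *m (Z0 *m E) = Z *m (A *m invmx B *m E).
Proof.
move=> Bu.
have -> : invmx B *m ((Z0 + e%:M) *m B) *m invmx B = invmx B *m Z0 + e *: invmx B.
  by rewrite -!mulmxA mulmxV // mulmx1 mulmxDr mul_mx_scalar.
rewrite -[(Z + _) *m A *m _]mulmxA [(Z + _) *m (A *m _)]mulmxDl mul_scalar_mx.
rewrite mulmxN mulmxDr -scalemxAr.
by rewrite opprD addrACA subrr addr0 mulmxDl mulNmx -!mulmxA -addrA addNr addr0.
Qed.

(* What the computation uses of the branches; the local branches on discs and the
   global rational data for integer rho both provide it. *)
Record kz_data (X : set (C * C)) (a : C -> C) (b : C * C -> C)
    (F F' : 'I_2 -> C * C -> C) (c d : C -> C) (H H' : 'I_2 -> C -> C) : Prop := KzData {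
  kz_dom : X `<=` kz_domain (R := R);
  kz_base : forall y z, X (y, z) -> X (0, z);
  kz_a0 : forall y z, X (y, z) -> a y != 0;
  kz_b0 : forall y z, X (y, z) -> b (y, z) != 0;
  kz_c0 : forall y z, X (y, z) -> c z != 0;
  kz_d0 : forall y z, X (y, z) -> d z != 0;
  kz_a : forall y z, X (y, z) -> hderC a y (- rho / (1 + y) * a y);
  kz_by : forall y z, X (y, z) ->
    hderC (fun t => b (t, z)) y (- rho * (1 + z) / (1 + y + y * z) * b (y, z));
  kz_bz : forall y z, X (y, z) ->
    hderC (fun t => b (y, t)) z (- rho * y / (1 + y + y * z) * b (y, z));
  kz_c : forall y z, X (y, z) -> hderC c z (- rho / z * c z);
  kz_d : forall y z, X (y, z) -> hderC d z (- rho / (1 + z) * d z);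
  kz_Fy : forall k y z, X (y, z) -> @solves_along (R[i] : numFieldType) rho
    (fun t => F k (t, z)) (fun t => F' k (t, z)) (fun t => s (t, z)) y ((z + 1) / z);
  kz_Fz : forall k y z, X (y, z) -> @solves_along (R[i] : numFieldType) rho
    (fun t => F k (y, t)) (fun t => F' k (y, t)) (fun t => s (y, t)) z (- (y + 1) / z ^+ 2);
  kz_H : forall k y z, X (y, z) -> @solves_along (R[i] : numFieldType) rho
    (H k) (H' k) (fun t => - t) z (- 1);
  kz_WF : forall y z, X (y, z) ->
    F 0 (y, z) * F' 1 (y, z) - F 1 (y, z) * F' 0 (y, z) != 0;
  kz_WH : forall y z, X (y, z) -> H 0 z * H' 1 z - H 1 z * H' 0 z != 0
}.

Definition kzY (y z : R[i]) : 'M[R[i]]_2 :=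
  rho *: ((1 + y)^-1 *: P R 1 3 + ((1 + z) / (1 + y + y * z)) *: P R 1 4).
Definition kzZ (y z : R[i]) : 'M[R[i]]_2 :=
  rho *: (z^-1 *: P R 4 3 + (1 + z)^-1 *: P R 4 2 + (y / (1 + y + y * z)) *: P R 4 1).

(** * The equations for W1 and W2, and their product *)

Section Core.
Variables (X : set (C * C)) (a : C -> C) (b : C * C -> C).
Variables (F F' : 'I_2 -> C * C -> C) (c d : C -> C) (H H' : 'I_2 -> C -> C).
Hypothesis D : kz_data X a b F F' c d H H'.

Lemma W1E y z : W1 rho a b F F' y z =
  solmx r3 rho (w1 R) (w2 R) (a y * b (y, z) : R[i]) (F^~ (y, z)) (F'^~ (y, z)) (s (y, z)).
Proof. by []. Qed.

(** With u = -z, the term z v2 reads u (- v2); this is where the sign of the second vector comes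
    from. *)
Lemma W2E z : W2 rho c d H H' z =
  solmx r3 rho (v1 R) (- v2 R) (c z * d z : R[i]) (H^~ z) (H'^~ z) (- z : R[i]).
Proof.
apply/matrixP => i k; rewrite /W2 /solmx.
rewrite [LHS]mxE [RHS]mxE /Uvec /solvec.
have E (q : R[i]) : ((- z : R[i]) / (r3 * rho) * q) *: - v2 R =
    ((z : R[i]) / (r3 * rho) * q) *: v2 R.
  by rewrite !mulNr scaleNr scalerN opprK.
by rewrite E.
Qed.

(** Since s - 1 = (1 + y + yz) / z, the inequations of the domain keep s away from the singular
    points 0 and 1. *)
Lemma dom_s y z : X (y, z) ->
  [/\ z != 0, 1 + z != 0, 1 + y != 0, 1 + y + y * z != 0 /\ (z + 1 != 0 /\ y + 1 != 0) &
   (s (y, z) : R[i]) != 0 /\ (s (y, z) : R[i]) - 1 != 0].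
Proof.
move=> /(kz_dom D)[/= z0 z1 y1 yz].
have z1' : 1 + z != 0 by rewrite addrC -[1]opprK subr_eq0.
have y1' : 1 + y != 0 by rewrite addrC -[1]opprK subr_eq0.
split => //; first by rewrite [z + 1]addrC [y + 1]addrC.
rewrite /s /=; split.
  by rewrite mulf_neq0 ?invr_eq0 // [y + 1]addrC [z + 1]addrC mulf_neq0.
rewrite [X in X != 0](_ : _ = (1 + y + y * z) / z) ?mulf_neq0 ?invr_eq0 //.
by field.
Qed.

Lemma W1_unit y z : X (y, z) -> W1 rho a b F F' y z \in unitmx.
Proof.
move=> yz; have [z0 z1 y1 [yz0 [zc yc]] [s0 s1]] := dom_s yz.
rewrite unitmxE unitfE W1E det_solmx oppr_eq0.
apply: mulf_neq0; [apply: mulf_neq0; [apply: mulf_neq0|]|].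
- by apply: expf_neq0; apply: mulf_neq0; [exact: (kz_a0 D yz)|exact: (kz_b0 D yz)].
- by rewrite mulf_neq0 ?oppr_eq0 // invr_eq0 mulf_neq0 // sqrt3_neq0.
- exact: (kz_WF D yz).
- by rewrite !mxE /= -expr2 sqrt3E; have -> : 3 - 1 * 1 = 2 :> R[i] by ring.
Qed.

Lemma W2_unit y z : X (y, z) -> W2 rho c d H H' z \in unitmx.
Proof.
move=> yz; have [z0 z1 y1 [yz0 [zc yc]] [s0 s1]] := dom_s yz.
rewrite unitmxE unitfE W2E det_solmx oppr_eq0.
apply: mulf_neq0; [apply: mulf_neq0; [apply: mulf_neq0|]|].
- by apply: expf_neq0; apply: mulf_neq0; [exact: (kz_c0 D yz)|exact: (kz_d0 D yz)].
- by rewrite mulf_neq0 ?oppr_eq0 // invr_eq0 mulf_neq0 // sqrt3_neq0.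
- exact: (kz_WH D yz).
- by rewrite !mxE /= mul0r sub0r mulrN opprK mulr1 pnatr_eq0.
Qed.

(** No scalar term is left over in this direction: for fixed z the prefactor is (s (s - 1))^(-rho)
    up to a constant. *)
Lemma W1_dery y z : X (y, z) ->
  mxder (fun t => W1 rho a b F F' t z) (y : R[i]) (kzY y z *m W1 rho a b F F' y z).
Proof.
move=> yz; have [z0 z1 y1 [yz0 [zc yc]] [s0 s1]] := dom_s yz.
have pred : hderC (fun t => a t * b (t, z) : R[i]) y
    (- rho * ((1 + y)^-1 + (1 + z) / (1 + y + y * z)) * (a y * b (y, z) : R[i])).
  apply: hder_eq (hderM (kz_a D yz) (kz_by D yz)) _.
  by move: (a y) (b _) => p q; ring.
have h := @solmx_der R[i] r3 rho sqrt3E rho0 (P13 R) (P14 R) (w1 R) (w2 R)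
  (fun t => a t * b (t, z)) (fun t => s (t, z)) (fun k t => F k (t, z)) (fun k t => F' k (t, z))
  y _ _ P13w1 P14w1 P13w2 P14w2 s0 s1 pred (fun k => kz_Fy D k yz).
apply: mxder_eq h _.
rewrite W1E; congr (_ *m _).
have -> : (z + 1) / z / (s (y, z) : R[i]) = (1 + y)^-1.
  by rewrite /s /=; field; rewrite ?z0 ?z1 ?y1 ?zc ?yc ?yz0.
have -> : (z + 1) / z / ((s (y, z) : R[i]) - 1) = (1 + z) / (1 + y + y * z).
  by rewrite /s /=; field; rewrite ?z0 ?z1 ?y1 ?zc ?yc ?yz0.
by rewrite shift_connection // mulrN; ring.
Qed.

(* The scalar term is the logarithmic derivative of ((1 + z)/z^2)^rho. *)
Lemma W1_derz y z : X (y, z) ->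
  mxder (fun t => W1 rho a b F F' y t) (z : R[i])
    ((kzZ y z + (rho * ((1 + z)^-1 - 2 / z))%:M) *m W1 rho a b F F' y z).
Proof.
move=> yz; have [z0 z1 y1 [yz0 [zc yc]] [s0 s1]] := dom_s yz.
have pred : hderC (fun t => a y * b (y, t) : R[i]) z
    (- rho * (y / (1 + y + y * z)) * (a y * b (y, z) : R[i])).
  apply: hder_eq (hderMl (a y) (kz_bz D yz)) _.
  by move: (a y) (b _) => p q; ring.
have h := @solmx_der R[i] r3 rho sqrt3E rho0 (P13 R) (P14 R) (w1 R) (w2 R)
  (fun t => a y * b (y, t)) (fun t => s (y, t)) (fun k t => F k (y, t)) (fun k t => F' k (y, t))
  z _ _ P13w1 P14w1 P13w2 P14w2 s0 s1 pred (fun k => kz_Fz D k yz).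
apply: mxder_eq h _.
rewrite W1E; congr (_ *m _).
have -> : - (y + 1) / z ^+ 2 / (s (y, z) : R[i]) = (1 + z)^-1 - z^-1.
  by rewrite /s /=; field; rewrite ?z0 ?z1 ?y1 ?zc ?yc ?yz0.
have -> : - (y + 1) / z ^+ 2 / ((s (y, z) : R[i]) - 1) = y / (1 + y + y * z) - z^-1.
  by rewrite /s /=; field; rewrite ?z0 ?z1 ?y1 ?zc ?yc ?yz0.
(* The two terms in [- z^-1] combine to -(P13 + P14) / z, which is the P43 term. *)
rewrite /kzZ (_ : P R 4 3 = - (P13 R + P14 R)); last exact: P_sum.
rewrite (_ : P R 4 2 = P13 R) // (_ : P R 4 1 = P14 R) //.
move: (P13 R) (P14 R) => A B; apply/matrixP => i j; rewrite !mxE.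
by case: (i == j); rewrite ?mulr1n ?mulr0n; ring.
Qed.

(** At y = 0 the P41 term drops out. The remaining poles z = 0 and z = -1 are the points 0 and 1 of
    u = -z, with residues P43 = P12 and P42 = P13. *)
Lemma W2_der y z : X (y, z) ->
  mxder (fun t => W2 rho c d H H' t) (z : R[i]) (kzZ 0 z *m W2 rho c d H H' z).
Proof.
move=> yz; have [z0 z1 y1 [yz0 [zc yc]] [s0 s1]] := dom_s yz.
have pred : hderC (fun t => c t * d t : R[i]) z
    (- rho * (z^-1 + (1 + z)^-1) * (c z * d z : R[i])).
  apply: hder_eq (hderM (kz_c D yz) (kz_d D yz)) _.
  by move: (c z) (d z) => p q; ring.
have u0 : - z != 0 :> R[i] by rewrite oppr_eq0.
have u1 : - z - 1 != 0 :> R[i] by rewrite -opprD oppr_eq0 addrC.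
have h := @solmx_der R[i] r3 rho sqrt3E rho0 (P12 R) (P13 R) (v1 R) (- v2 R)
  (fun t => c t * d t) (fun t => - t) H H'
  z _ _ P12v1 P13v1 P12v2 P13v2 u0 u1 pred (fun k => kz_H D k yz).
have {}h i j : hderC (fun t => W2 rho c d H H' t i j) z
  (((rho *: ((-1 / - z) *: (P12 R + 1%:M) + (-1 / (- z - 1)) *: (P13 R + 1%:M)) +
     (- rho * (z^-1 + (1 + z)^-1))%:M) *m W2 rho c d H H' z) i j).
  by rewrite W2E; apply: hder_ext (h i j) _ => t; rewrite W2E.
apply: mxder_eq h _; congr (_ *m _).
have -> : -1 / - z = z^-1 :> R[i] by field.
have -> : -1 / (- z - 1) = (1 + z)^-1 :> R[i].
  by field; rewrite z1 -opprD oppr_eq0 addrC z1.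
by rewrite shift_connection /kzZ mul0r scale0r addr0.
Qed.

(** Only the first factor depends on y. In z, the inverse of W1(0,z) contributes minus the
    connection at y = 0 and minus the scalar of W1(y,z); W2 restores the connection at y = 0. *)
Lemma kz_core : kz_fundamental_on rho X (W rho a b F F' c d H H').
Proof.
move=> y z yz; have yz0 := kz_base D yz.
have W1u := W1_unit yz; have W10u := W1_unit yz0; have W2u := W2_unit yz.
split.
- have unit3 (A B E : 'M[R[i]]_2) : A \in unitmx -> B \in unitmx -> E \in unitmx ->
      A *m invmx B *m E \in unitmx.
    by move=> uA uB uE; rewrite !unitmx_mul uA unitmx_inv uB.
  exact: unit3.
- move=> i j.
  have h := mxderM (mxderM (W1_dery yz) (mxder_cst (invmx (W1 rho a b F F' 0 z)) y))
    (mxder_cst (W2 rho c d H H' z) y).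
  apply: hder_eq (h i j) _.
  rewrite -/(kzY y z) /W; move: (W1 _ _ _ _ _ y z) (invmx _) (W2 _ _ _ _ _ z) => A B E.
  by rewrite !mulmx0 !addr0 -!mulmxA.
- move=> i j; have h := mxderM (mxderM (W1_derz yz) (mxderV W10u (W1_derz yz0))) (W2_der yz).
  apply: hder_eq (h i j) _; congr (fun_of_matrix _ _ _).
  rewrite -/(kzZ y z) /W.
  move: W10u; move: (W1 _ _ _ _ _ y z) (W1 _ _ _ _ _ 0 z) (W2 _ _ _ _ _ z) => A B E Bu.
  exact: gauge_cancel.
Qed.
End Core.
End KZ.

Lemma hder_derive1 (K : numFieldType) (f : K -> K) x :
  derivable f x 1 -> hder f x (f^`()%classic x).
Proof. by move=> fd; rewrite derive1E; exact: derivableP. Qed.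

Lemma gauss2E (K : numFieldType) (rho v p0 p1 p2 : K) : v != 0 -> v != 1 ->
  v * (1 - v) * p2 + (1 - 2 * rho - (- rho + - (3 * rho) + 1) * v) * p1
    - - rho * - (3 * rho) * p0 = 0 -> p2 = gauss2 rho v p0 p1.
Proof.
move=> v0 v1 /eqP; rewrite subr_eq0 => /eqP eq.
have v1' : 1 - v != 0 by rewrite subr_eq0 eq_sym.
apply: (mulfI (mulf_neq0 v0 v1')); rewrite /gauss2 mulrC.
rewrite [in LHS]mulrC -[LHS](addrK ((1 - 2 * rho - (- rho + - (3 * rho) + 1) * v) * p1)) eq.
by field; rewrite v0 v1'.
Qed.

(** * Branches on discs *)

Section Data.
Variables (R : realType) (rho : R[i]).
Notation C := (Cx R).
Notation hderC := (@hder (R[i] : numFieldType)).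
(* [R[i]] alone carries no topology; this form lets the one of a numFieldType be
   inferred. *)
Notation K := (Num.NumField.sort (R[i] : numFieldType)).
Notation along := (@solves_along (R[i] : numFieldType) rho).

Lemma psi_eq_hder (psi : C -> C) (v : C) : psi_eq_at rho psi v -> v != 0 -> v != 1 ->
  hderC psi v (derive1 psi v) /\
  hderC (derive1 psi) v (gauss2 rho v (psi v) (derive1 psi v)).
Proof.
move=> [d1 d2 eq] v0 v1.
split; first exact: (@hder_derive1 R[i] psi v d1).
have h := @hder_derive1 R[i] (derive1 psi) v d2.
apply: hder_eq h _.
move: eq; rewrite derive1nS derive1n1; exact: (@gauss2E R[i]).
Qed.

(** The curve [j] is meant to be a coordinate line. It stays in [X] near [t], so the local identity
    within [X] holds on a full neighbourhood of [t] and the chain rule applies to one local psi. *)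
Lemma solution_along_curve (T : topologicalType) (X : set T) (phi F F' : T -> C)
    (j : K -> T) (t du : K) :
  solution_along rho X phi F F' -> X (j t) -> (\forall t' \near t, X (j t')) ->
  {for t, continuous j} -> hderC (fun t' => phi (j t')) t du ->
  phi (j t) != 0 -> phi (j t) != 1 ->
  along (fun t' => F (j t')) (fun t' => F' (j t')) (fun t' => phi (j t')) t du.
Proof.
move=> sol Xt Xnear jc phid phi0 phi1.
have [psi [psin FE]] := sol _ Xt.
have psit := nbhs_singleton psin.
have [hpsi hpsi'] := psi_eq_hder psit phi0 phi1.
have near' : \forall t' \near t,
    psi (phi (j t')) = F (j t') /\ derive1 psi (phi (j t')) = F' (j t').
  have FEj : \forall t' \near t, X (j t') ->
    F (j t') = psi (phi (j t')) /\ F' (j t') = derive1 psi (phi (j t')) := jc _ FE.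
  by apply: filterS2 Xnear FEj => t' Xt' /(_ Xt')[-> ->].
have Ft : psi (phi (j t)) = F (j t) /\ derive1 psi (phi (j t)) = F' (j t) :=
  nbhs_singleton near'.
split => //.
- have h := @hder_comp R[i] psi (fun t' => phi (j t')) t _ _ hpsi phid.
  apply: (hder_near (hder_eq h _)); first by rewrite Ft.2.
  by apply: (filterS _ near') => t' [].
- have h := @hder_comp R[i] (derive1 psi) (fun t' => phi (j t')) t _ _ hpsi' phid.
  apply: (hder_near (hder_eq h _)); first by rewrite Ft.1 Ft.2.
  by apply: (filterS _ near') => t' [].
Qed.

(** The branch [logu] is only known to be differentiable; its derivative is found by differentiating
    cexp (logu) = u. *)
Lemma power_branch_curve (V : normedModType R[i]) (X : set V) (u : V -> C) (a : C)
    (Q : V -> C) (j : K -> V) (t du : K) :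
  power_branch X u a Q -> X (j t) -> (\forall t' \near t, X (j t')) ->
  differentiable j t -> hderC (fun t' => u (j t')) t du ->
  [/\ hderC (fun t' => Q (j t')) t (a * du / u (j t) * Q (j t)), u (j t) != 0 & Q (j t) != 0].
Proof.
move=> [logu lP] Xt Xnear jd ud.
have [ld lu QE] := lP _ Xt.
have [dl ldj] : exists dl, hderC (fun t' => logu (j t')) t dl.
  have cd := @differentiable_comp R[i] K V C j logu t jd ld.
  exists ('D_1 (logu \o j) t); apply: derivableP.
  exact: ((@derivable1_diffP R[i] K _ _).2 cd).
have u0 : u (j t) != 0 by rewrite -lu cexp_neq0.
have duE : du = u (j t) * dl.
  apply: hder_uniq ud _.
  have h := @hder_comp R[i] (@cexp R) (fun t' => logu (j t')) t _ _ (hder_cexp _) ldj.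
  apply: (hder_near (hder_eq h _)); first by rewrite lu.
  by apply: (filterS _ Xnear) => t' /lP[].
split => //; last by rewrite QE cexp_neq0.
have h := @hder_comp R[i] (@cexp R) (fun t' => a * logu (j t')) t _ _
  (hder_cexp _) (hderMl a ldj).
apply: (hder_near (hder_eq h _)).
  by rewrite -QE duE; move: (Q _) u0; move: (u _) => w q w0; field.
by apply: (filterS _ Xnear) => t' /lP[].
Qed.

End Data.

Lemma solves_along_comb (K : numFieldType) (rho : K)
    (F0 F1 F0' F1' u : K -> K) (t du a0 a1 : K) :
  solves_along rho F0 F0' u t du -> solves_along rho F1 F1' u t du ->
  solves_along rho (fun x => a0 * F0 x + a1 * F1 x) (fun x => a0 * F0' x + a1 * F1' x) u t du.
Proof.
move=> [ud d0 d0'] [_ d1 d1']; split=> //.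
  by apply: hder_eq (hderD (hderMl a0 d0) (hderMl a1 d1)) _; ring.
apply: hder_eq (hderD (hderMl a0 d0') (hderMl a1 d1')) _.
by rewrite /gauss2; move: (_ ^-1) => q; ring.
Qed.

(** * Uniqueness along segments and nonvanishing Wronskians *)

Section Local.
Variables (R : realType) (rho : R[i]).
Notation C := (Cx R).
Notation K := (Num.NumField.sort (R[i] : numFieldType)).
Notation along := (@solves_along (R[i] : numFieldType) rho).

Lemma disc_segment (c p q : C) (r t : R) : disc c r p -> disc c r (p + q) ->
  0 <= t <= 1 -> disc c r (p + t%:C * q).
Proof.
rewrite /disc /= => pr qr t01.
have -> : p + t%:C * q - c = (1 - t)%:C * (p - c) + t%:C * (p + q - c).
  by rewrite rmorphB /=; ring.
have [P PE] : exists P : R, `|p - c| = P%:C by rewrite normc_def; eexists.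
have [Q QE] : exists Q : R, `|p + q - c| = Q%:C by rewrite normc_def; eexists.
have nrm (u : R) : 0 <= u -> `|u%:C| = u%:C :> R[i].
  by move=> u0; rewrite ger0_norm // lecR.
apply: le_lt_trans (ler_normD _ _) _.
have /andP[t0 t1] := t01; have t1' : 0 <= 1 - t by rewrite subr_ge0.
rewrite !normrM !nrm // PE QE -!rmorphM -rmorphD /= ltcR.
move: pr qr; rewrite PE QE !ltcR => Pr Qr.
have [->|t_neq0] := eqVneq t 0; first by lra.
have : 0 < t by rewrite lt_def t_neq0.
nra.
Qed.

Lemma disc_open (c : C) (r : R) (p : K) : disc c r p -> \forall t \near p, disc c r t.
Proof.
rewrite /disc /= => pr; apply/nearP_dist.
exists (r%:C - `|p - c|); first by rewrite subr_gt0.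
move=> w; rewrite ltrBrDr; apply: le_lt_trans.
by rewrite -[w - c](subrKA p) ; exact: ler_normD.
Qed.

(** The second-order equation becomes a first-order system in (F, F'); avoiding 0 and 1 makes its
    coefficients differentiable along the segment. *)
Lemma along_uniq (F F' u du : K -> K) (p q : K) :
  (forall t : R, 0 <= t <= 1 -> let x := p + t%:C * (q - p) in
    [/\ along F F' u x (du x), u x != 0, u x != 1 & diffC du x]) ->
  F p = 0 -> F' p = 0 -> F q = 0 /\ F' q = 0.
Proof.
move=> H Fp F'p; have := @linear_system_uniq R F F' du
  (fun x => 3 * rho ^+ 2 / (u x * (1 - u x)) * du x)
  (fun x => - (1 - 2 * rho - (1 - 4 * rho) * u x) / (u x * (1 - u x)) * du x) p (q - p).
rewrite subrKC; move=> U; apply: U Fp F'p => t t01 x.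
have [[ud Fd F'd] u0 u1 [ddu dud]] := H t t01.
have u1' : 1 - u x != 0 by rewrite subr_eq0 eq_sym.
have u01 : u x * (1 - u x) != 0 by rewrite mulf_neq0.
have h := hderM ud (hderB (hder_cst 1 x) ud).
have iud := hderV (f := fun x => u x * (1 - u x)) u01 h.
split.
- by rewrite mulrC.
- apply: hder_eq F'd _; rewrite /gauss2; field.
  by rewrite u0 u1'.
- by exists ddu.
- eexists; exact: hderM (hderMl _ iud) dud.
- have nd := hderN (hderB (hder_cst (1 - 2 * rho) x) (hderMl (1 - 4 * rho) ud)).
  by eexists; apply: hderM (hderM nd iud) dud.
Qed.

(* If the Wronskian vanishes at p, then the combination with coefficients
   (F1 p, - F0 p), or (F1' p, - F0' p), vanishes at p together with its derivative. *)
Lemma wronskian_neq0 (T : Type) (X : set T) (F F' : 'I_2 -> T -> C) (p : T) :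
  lin_indep_on X F ->
  (forall a0 a1 : R[i], a0 * F 0 p + a1 * F 1 p = 0 -> a0 * F' 0 p + a1 * F' 1 p = 0 ->
     forall q, X q -> a0 * F 0 q + a1 * F 1 q = 0) ->
  F 0 p * F' 1 p - F 1 p * F' 0 p != 0.
Proof.
move=> indep ext; apply/eqP => W0.
have comb (a0 a1 : R[i]) : a0 * F 0 p + a1 * F 1 p = 0 -> a0 * F' 0 p + a1 * F' 1 p = 0 ->
    a0 = 0 /\ a1 = 0.
  move=> h h'; have := indep (fun k => if k == 0 then a0 else a1).
  have e1 : lift 0 0 = 1 :> 'I_2 by exact: val_inj.
  move=> h2; have k0 : forall k : 'I_2, (if k == 0 then a0 else a1) = 0.
    by apply: h2 => q Xq; rewrite big_ord_recl big_ord1 e1 /=; exact: ext.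
  by split; [have := k0 0|have := k0 1].
have [F1 F0] : F 1 p = 0 /\ - F 0 p = 0.
  by apply: comb; [ring|rewrite -[RHS]oppr0 -W0; ring].
have [F1' F0'] : F' 1 p = 0 /\ - F' 0 p = 0.
  move/eqP: F0; rewrite oppr_eq0 => /eqP F0.
  by apply: comb; [rewrite F0 F1; ring|ring].
move/eqP: F0; rewrite oppr_eq0 => /eqP F0.
move/eqP: F0'; rewrite oppr_eq0 => /eqP F0'.
(* All four values at [p] vanish, so even the combination with coefficients (1, 0) satisfies the
   hypotheses of [comb]. *)
have [/eqP] : (1 : R[i]) = 0 /\ (0 : R[i]) = 0.
  by apply: comb; rewrite ?F0 ?F0' ?F1 ?F1'; ring.
by rewrite oner_eq0.
Qed.

End Local.

Section LocalData.
Variables (R : realType) (rho : R[i]).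
Notation C := (Cx R).
Notation hderC := (@hder (R[i] : numFieldType)).
Notation K := (Num.NumField.sort (R[i] : numFieldType)).
Notation along := (@solves_along (R[i] : numFieldType) rho).

Lemma slicey_diff (y : K) (z : C) : differentiable (fun t : K => (t, z) : C * C) y.
Proof.
apply: (@differentiable_pair R[i] K C C id (cst z) y).
  by apply: (@derivable1_diffP R[i] C id y).1; case: (hder_id y).
exact: differentiable_cst.
Qed.

Lemma slicez_diff (y : C) (z : K) : differentiable (fun t : K => (y, t) : C * C) z.
Proof.
apply: (@differentiable_pair R[i] K C C (cst y) id z).
  exact: differentiable_cst.
by apply: (@derivable1_diffP R[i] C id z).1; case: (hder_id z).
Qed.

Lemma s_dery (y z : K) : z != 0 -> hderC (fun t => s (t, z)) y ((z + 1) / z).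
Proof.
move=> z0; rewrite /s /=.
apply: hder_eq (hderMr _ (hderMr _ (hderD (hder_id y) (hder_cst 1 y)))) _.
by rewrite addr0 mul1r.
Qed.

Lemma s_derz (y z : K) : z != 0 -> hderC (fun t => s (y, t)) z (- (y + 1) / z ^+ 2).
Proof.
move=> z0; rewrite /s /=.
have h := hderM (hderMl (y + 1) (hderD (hder_id z) (hder_cst 1 z))) (hderV z0 (hder_id z)).
by apply: hder_eq h _; field.
Qed.

Lemma kz_domain_s (p : C * C) : kz_domain p -> s p != 0 /\ s p != 1.
Proof.
case: p => y z [/= z0 z1 y1 yz].
have z1' : z + 1 != 0 :> R[i] by rewrite -[1]opprK subr_eq0.
have y1' : y + 1 != 0 :> R[i] by rewrite -[1]opprK subr_eq0.
have h0 : (y + 1) * (z + 1) / z != 0 :> R[i] by rewrite !mulf_neq0 ?invr_eq0.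
have h1 : (y + 1) * (z + 1) / z != 1 :> R[i].
  rewrite -subr_eq0 [X in X != 0](_ : _ = (1 + y + y * z) / z :> R[i]).
    by rewrite mulf_neq0 ?invr_eq0.
  by field.
by split.
Qed.

(** * The data given by branches on a product of discs *)

Section Discs.
Variables (y0 z0 : C) (r1 r2 : R).
Variables (a : C -> C) (b : C * C -> C) (F F' : 'I_2 -> C * C -> C).
Variables (c d : C -> C) (H H' : 'I_2 -> C -> C).
Let D1 := disc y0 r1.
Let D2 := disc z0 r2.
Hypothesis D10 : D1 0.
Hypothesis D12 : D1 `*` D2 `<=` kz_domain (R := R).
Hypothesis pa : power_branch D1 (fun y => 1 + y) (- rho) a.
Hypothesis pb : power_branch (D1 `*` D2) (fun p => 1 + p.1 + p.1 * p.2) (- rho) b.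
Hypothesis pc : power_branch D2 (fun z => z) (- rho) c.
Hypothesis pd : power_branch D2 (fun z => 1 + z) (- rho) d.
Hypothesis Fsol : forall k, solution_along rho (D1 `*` D2) (s (R := R)) (F k) (F' k).
Hypothesis Find : lin_indep_on (D1 `*` D2) F.
Hypothesis Hsol : forall k, solution_along rho D2 (fun z => - z) (H k) (H' k).
Hypothesis Hind : lin_indep_on D2 H.

Lemma D12_y y z : (D1 `*` D2) (y, z) -> \forall t \near (y : K), (D1 `*` D2) (t, z).
Proof.
move=> [/= Dy Dz].
have h := disc_open Dy.
by apply: filterS h => t Dt; split.
Qed.

Lemma D12_z y z : (D1 `*` D2) (y, z) -> \forall t \near (z : K), (D1 `*` D2) (y, t).
Proof.
move=> [/= Dy Dz].
have h := disc_open Dz.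
by apply: filterS h => t Dt; split.
Qed.

Lemma F_alongy k y z : (D1 `*` D2) (y, z) ->
  along (fun t => F k (t, z)) (fun t => F' k (t, z)) (fun t => s (t, z)) y ((z + 1) / z).
Proof.
move=> yz; have dom := D12 yz; have [s0 s1] := kz_domain_s dom.
have [/= z_0 _ _ _] := dom.
have jc := @differentiable_continuous R[i] K _ _ _ (@slicey_diff y z).
exact: (@solution_along_curve R rho _ _ _ _ _ (fun t : K => (t, z)) y _ (Fsol k) yz
  (D12_y yz) jc (s_dery y z_0) s0 s1).
Qed.

Lemma F_alongz k y z : (D1 `*` D2) (y, z) ->
  along (fun t => F k (y, t)) (fun t => F' k (y, t)) (fun t => s (y, t)) z
    (- (y + 1) / z ^+ 2).
Proof.
move=> yz; have dom := D12 yz; have [s0 s1] := kz_domain_s dom.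
have [/= z_0 _ _ _] := dom.
have jc := @differentiable_continuous R[i] K _ _ _ (@slicez_diff y z).
exact: (@solution_along_curve R rho _ _ _ _ _ (fun t : K => (y, t)) z _ (Fsol k) yz
  (D12_z yz) jc (s_derz y z_0) s0 s1).
Qed.

Lemma D2_dom z : D2 z -> z != 0 /\ z != -1.
Proof. by move=> Dz; have [//= ? ? _ _] := D12 (conj D10 Dz : (D1 `*` D2) (0, z)). Qed.

Lemma H_along k z : D2 z -> along (H k) (H' k) (fun t => - t) z (- 1).
Proof.
move=> Dz; have [z_0 z_1] := D2_dom Dz.
have u0 : - z != 0 :> R[i] by rewrite oppr_eq0.
have u1 : - z != 1 :> R[i] by rewrite eqr_oppLR.
have jc : {for (z : K), continuous (fun t : K => t : C)} by exact: cvg_id.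
exact: (@solution_along_curve R rho _ _ _ _ _ (fun t : K => t) z _ (Hsol k) Dz
  (disc_open Dz) jc (hderN (hder_id z)) u0 u1).
Qed.

Lemma D12I y z : D1 y -> D2 z -> (D1 `*` D2) (y, z).
Proof. by []. Qed.

(** The points are joined through the corner (yq, zp) by a segment in y and one in z. The same F'
    serves in both directions, so the vanishing of value and derivative at the corner starts the
    second leg. *)
Lemma F_ext a0 a1 p : (D1 `*` D2) p ->
  a0 * F 0 p + a1 * F 1 p = 0 :> R[i] -> a0 * F' 0 p + a1 * F' 1 p = 0 :> R[i] ->
  forall q, (D1 `*` D2) q -> a0 * F 0 q + a1 * F 1 q = 0 :> R[i].
Proof.
case: p => yp zp Dp h h' [yq zq] Dq.
have [Dyp Dzp] : D1 yp /\ D2 zp by case: Dp.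
have [Dyq Dzq] : D1 yq /\ D2 zq by case: Dq.
have Uy := @along_uniq R rho (fun y => a0 * F 0 (y, zp) + a1 * F 1 (y, zp))
   (fun y => a0 * F' 0 (y, zp) + a1 * F' 1 (y, zp)) (fun y => s (y, zp))
   (fun=> (zp + 1) / zp) yp yq.
have [t t01 x|g g'] := Uy _ h h'.
  have Dt : D1 x by apply: disc_segment => //; rewrite subrKC.
  have Dx := D12I Dt Dzp.
  have [s0 s1] := kz_domain_s (D12 Dx).
  split; [|exact: s0|exact: s1|by exists 0; exact: hder_cst].
  exact: solves_along_comb (F_alongy 0 Dx) (F_alongy 1 Dx).
have Uz := @along_uniq R rho (fun z => a0 * F 0 (yq, z) + a1 * F 1 (yq, z))
   (fun z => a0 * F' 0 (yq, z) + a1 * F' 1 (yq, z)) (fun z => s (yq, z))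
   (fun z => - (yq + 1) / z ^+ 2) zp zq.
apply: (Uz _ g g').1 => t t01 x.
have Dt : D2 x by apply: disc_segment => //; rewrite subrKC.
have Dx := D12I Dyq Dt.
have [s0 s1] := kz_domain_s (D12 Dx).
split; [|exact: s0|exact: s1|].
  exact: solves_along_comb (F_alongz 0 Dx) (F_alongz 1 Dx).
have x_0 : x != 0 by have [] := D12 Dx.
eexists; apply: hderMl; apply: hderV (hderX 2 (hder_id _)); exact: expf_neq0.
Qed.

Lemma H_ext a0 a1 p : D2 p ->
  a0 * H 0 p + a1 * H 1 p = 0 :> R[i] -> a0 * H' 0 p + a1 * H' 1 p = 0 :> R[i] ->
  forall q, D2 q -> a0 * H 0 q + a1 * H 1 q = 0 :> R[i].
Proof.
move=> Dp h h' q Dq.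
have U := @along_uniq R rho (fun z => a0 * H 0 z + a1 * H 1 z)
   (fun z => a0 * H' 0 z + a1 * H' 1 z) (fun z => - z) (fun=> - 1) p q.
apply: (U _ h h').1 => t t01 x.
have Dt : D2 x by apply: disc_segment => //; rewrite subrKC.
have [z_0 z_1] := D2_dom Dt.
split; [|by rewrite oppr_eq0|by rewrite eqr_oppLR|by exists 0; exact: hder_cst].
exact: solves_along_comb (H_along 0 Dt) (H_along 1 Dt).
Qed.

Lemma local_kz_data : kz_data rho (D1 `*` D2) a b F F' c d H H'.
Proof.
have ay y z : (D1 `*` D2) (y, z) -> hderC a y (- rho / (1 + y) * a y) /\ a y != 0.
  move=> [/= Dy Dz].
  have jd := (@derivable1_diffP R[i] C id (y : K)).1
    (@ex_derive _ _ _ _ _ _ _ (hder_id (y : K))).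
  have ud := hderD (hder_cst 1 (y : K)) (hder_id (y : K)).
  have [h _ h0] := @power_branch_curve R C D1 _ _ _ id y _ pa Dy (disc_open Dy) jd ud.
  by split => //; apply: hder_eq h _; rewrite add0r mulr1.
have by_ y z : (D1 `*` D2) (y, z) ->
    hderC (fun t => b (t, z)) y (- rho * (1 + z) / (1 + y + y * z) * b (y, z)) /\
    b (y, z) != 0.
  move=> Dp.
  have ud := hderD (hderD (hder_cst 1 (y : K)) (hder_id (y : K)))
    (hderMr (z : K) (hder_id (y : K))).
  have [h _ h0] := @power_branch_curve R _ _ _ _ _ (fun t : K => (t, z)) y _
    pb Dp (D12_y Dp) (slicey_diff _ _) ud.
  by split => //; apply: hder_eq h _; rewrite add0r mul1r.
have bz y z : (D1 `*` D2) (y, z) ->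
    hderC (fun t => b (y, t)) z (- rho * y / (1 + y + y * z) * b (y, z)).
  move=> Dp.
  have ud := hderD (hder_cst (1 + y : R[i]) (z : K)) (hderMl (y : K) (hder_id (z : K))).
  have [h _ _] := @power_branch_curve R _ _ _ _ _ (fun t : K => (y, t)) z _
    pb Dp (D12_z Dp) (slicez_diff _ _) ud.
  by apply: hder_eq h _; rewrite add0r mulr1.
have cz y z : (D1 `*` D2) (y, z) -> hderC c z (- rho / z * c z) /\ c z != 0.
  move=> [/= Dy Dz].
  have jd := (@derivable1_diffP R[i] C id (z : K)).1
    (@ex_derive _ _ _ _ _ _ _ (hder_id (z : K))).
  have [h _ h0] := @power_branch_curve R C D2 _ _ _ id z _ pc Dz (disc_open Dz) jd
    (hder_id (z : K)).
  by split => //; apply: hder_eq h _; rewrite mulr1.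
have dz y z : (D1 `*` D2) (y, z) -> hderC d z (- rho / (1 + z) * d z) /\ d z != 0.
  move=> [/= Dy Dz].
  have jd := (@derivable1_diffP R[i] C id (z : K)).1
    (@ex_derive _ _ _ _ _ _ _ (hder_id (z : K))).
  have ud := hderD (hder_cst 1 (z : K)) (hder_id (z : K)).
  have [h _ h0] := @power_branch_curve R C D2 _ _ _ id z _ pd Dz (disc_open Dz) jd ud.
  by split => //; apply: hder_eq h _; rewrite add0r mulr1.
split.
- exact: D12.
- by move=> y z [].
- by move=> y z /ay[].
- by move=> y z /by_[].
- by move=> y z /cz[].
- by move=> y z /dz[].
- by move=> y z /ay[].
- by move=> y z /by_[].
- exact: bz.
- by move=> y z /cz[].
- by move=> y z /dz[].
- by move=> k y z; exact: F_alongy.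
- by move=> k y z; exact: F_alongz.
- by move=> k y z []; move=> _; exact: H_along.
- move=> y z Dp; apply: wronskian_neq0 Find _ => a0 a1; exact: F_ext.
- move=> y z [_ Dz]; apply: wronskian_neq0 Hind _ => a0 a1; exact: H_ext.
Qed.

End Discs.
End LocalData.

Lemma hder_horner (K : numFieldType) (p : {poly K}) x :
  hder (fun t => p.[t]) x p^`().[x].
Proof.
elim/poly_ind: p => [|p r IH].
  by apply: hder_ext (hder_eq (hder_cst 0 x) _) _ => [|t]; rewrite ?deriv0 hornerC.
apply: hder_ext (hder_eq (hderD (hderM IH (hder_id x)) (hder_cst r x)) _) _ => [|t].
  by rewrite derivMXaddC !hornerE; ring.
by rewrite hornerMXaddC.
Qed.

Lemma poly_eq0_near (K : numFieldType) (p : {poly K}) (v r : K) : 0 < r ->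
  (forall w, `|w - v| < r -> p.[w] = 0) -> p = 0.
Proof.
move=> r0 pw; apply/eqP; apply: contraT => p0.
(* These are distinct roots, as many as the size of p, which is one too many; [n.+2] keeps r / (n +
   2) strictly below r. *)
pose rs := [seq v + r / n.+2%:R | n <- iota 0 (size p)].
have : (size rs < size p)%N.
  apply: max_poly_roots => //.
    apply/allP => w /mapP[n _ ->]; rewrite /root pw // addrAC subrr add0r.
    rewrite normf_div gtr0_norm // ger0_norm ?ler0n //.
    by rewrite ltr_pdivrMr ?ltr0n // ltr_pMr // ltr1n.
  rewrite map_inj_uniq ?iota_uniq // => i j /addrI /(mulfI (lt0r_neq0 r0)) /invr_inj.
  by move=> /eqP; rewrite eqr_nat => /eqP[].
by rewrite size_map size_iota ltnn.
Qed.

(** * Rational functions of two variables *)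

Section Rational.
Variable R : realType.
Notation C := (Cx R).
Notation K := (Num.NumField.sort (R[i] : numFieldType)).
Implicit Types (X : set (C * C)) (f g : K -> K -> K).
Notation ev p y z := ((p : {poly {poly R[i]}}).[(y : R[i])%:P].[z : R[i]]).

Lemma rat2_ext X f g : rational2_on X f ->
  (forall y z, X (y, z) -> f y z = g y z) -> rational2_on X g.
Proof.
move=> [p [q h]] fg; exists p, q => y z yz.
by have [q0 fE] := h y z yz; rewrite -fg.
Qed.

Lemma rat2_sub X X' f : X' `<=` X -> rational2_on X f -> rational2_on X' f.
Proof. by move=> XX [p [q h]]; exists p, q => y z /XX; exact: h. Qed.

Lemma rat2_poly X (p : {poly {poly R[i]}}) : rational2_on X (fun y z => ev p y z : C).
Proof. by exists p, 1 => y z _; rewrite !hornerE oner_eq0 divr1. Qed.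

Lemma rat2_cst X (k : K) : rational2_on X (fun _ _ => k).
Proof. by apply: rat2_ext (rat2_poly X k%:P%:P) _ => y z _; rewrite !hornerE. Qed.

Lemma rat2_y X : rational2_on X (fun y _ => y).
Proof. by apply: rat2_ext (rat2_poly X 'X) _ => y z _; rewrite !hornerE. Qed.

Lemma rat2_z X : rational2_on X (fun _ z => z).
Proof. by apply: rat2_ext (rat2_poly X 'X%:P) _ => y z _; rewrite !hornerE. Qed.

Lemma rat2D X f g : rational2_on X f -> rational2_on X g ->
  rational2_on X (fun y z => f y z + g y z).
Proof.
move=> [p [q h]] [p' [q' h']]; exists (p * q' + p' * q), (q * q') => y z yz.
have [q0 ->] := h y z yz; have [q'0 ->] := h' y z yz.
by rewrite !hornerE mulf_neq0 //; split => //; exact: addf_div.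
Qed.

Lemma rat2M X f g : rational2_on X f -> rational2_on X g ->
  rational2_on X (fun y z => f y z * g y z).
Proof.
move=> [p [q h]] [p' [q' h']]; exists (p * p'), (q * q') => y z yz.
have [q0 ->] := h y z yz; have [q'0 ->] := h' y z yz.
by rewrite !hornerM mulf_neq0 //; split => //; exact: mulf_div.
Qed.

Lemma rat2N X f : rational2_on X f -> rational2_on X (fun y z => - f y z).
Proof.
by move=> h; apply: rat2_ext (rat2M (rat2_cst X (-1)) h) _ => y z _; rewrite mulN1r.
Qed.

Lemma rat2V X f : rational2_on X f -> (forall y z, X (y, z) -> f y z != 0) ->
  rational2_on X (fun y z => (f y z)^-1).
Proof.
move=> [p [q h]] f0; exists q, p => y z yz.
have [q0 fE] := h y z yz; have := f0 y z yz; rewrite fE mulf_eq0 invr_eq0 negb_or.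
by move=> /andP[p0 _]; rewrite invf_div.
Qed.

Lemma rat2X X f n : rational2_on X f -> rational2_on X (fun y z => f y z ^+ n).
Proof.
move=> h; elim: n => [|n IH]; first exact: rat2_cst.
by apply: rat2_ext (rat2M h IH) _ => y z _; rewrite exprS.
Qed.

Lemma rat2Xz X f (n : int) : rational2_on X f -> (forall y z, X (y, z) -> f y z != 0) ->
  rational2_on X (fun y z => f y z ^ n).
Proof.
move=> h f0; case: n => n; first exact: rat2X.
by apply: rat2V (rat2X n.+1 h) _ => y z yz; rewrite expf_neq0 // f0.
Qed.

Lemma rat2_horner X f (p : {poly R[i]}) : rational2_on X f ->
  rational2_on X (fun y z => p.[f y z]).
Proof.
move=> h; elim/poly_ind: p => [|p k IH].
  by apply: rat2_ext (rat2_cst X 0) _ => y z _; rewrite horner0.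
apply: rat2_ext (rat2D (rat2M IH h) (rat2_cst X k)) _ => y z _.
by rewrite hornerMXaddC.
Qed.

(** Numerator and denominator are specialised at y = 0 and viewed as constants in y; the denominator
    stays nonzero because (0, z) is again in [X]. *)
Lemma rat2_base X f : (forall y z, X (y, z) -> X (0, z)) -> rational2_on X f ->
  rational2_on X (fun _ z => f 0 z).
Proof.
move=> X0 [p [q h]]; exists (p.[0]%:P), (q.[0]%:P) => y z /X0 /h.
by rewrite !hornerC.
Qed.

Lemma rat2_s X : X `<=` kz_domain (R := R) -> rational2_on X (fun y z => s (y, z)).
Proof.
move=> Xd; rewrite /s /=; apply: rat2M; last first.
  by apply: rat2V (rat2_z X) _ => y z /Xd[].
by apply: rat2M; apply: rat2D (rat2_cst X 1); [exact: rat2_y|exact: rat2_z].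
Qed.

Definition mxrat2 X m n (M : K -> K -> 'M[R[i]]_(m, n)) :=
  forall i j, rational2_on X (fun y z => M y z i j).

Lemma mxrat2M X m n p (M : K -> K -> 'M[R[i]]_(m, n)) (N : K -> K -> 'M[R[i]]_(n, p)) :
  mxrat2 X M -> mxrat2 X N -> mxrat2 X (fun y z => M y z *m N y z).
Proof.
move=> hM hN i j.
have h : rational2_on X (fun y z => \sum_k (M y z i k * N y z k j : C)).
  elim: (index_enum _) => [|k r IH].
    by apply: rat2_ext (rat2_cst X 0) _ => y z _; rewrite big_nil.
  apply: rat2_ext (rat2D (rat2M (hM i k) (hN k j)) IH) _ => y z _.
  by rewrite big_cons.
by apply: rat2_ext h _ => y z _; rewrite mxE.
Qed.

Lemma mxrat2V X (M : K -> K -> 'M[R[i]]_2) : mxrat2 X M ->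
  (forall y z, X (y, z) -> M y z \in unitmx) -> mxrat2 X (fun y z => invmx (M y z)).
Proof.
move=> hM Mu i j.
have dM : rational2_on X (fun y z => \det (M y z)).
  have h := rat2D (rat2M (hM 0 0) (hM 1 1)) (rat2N (rat2M (hM 0 1) (hM 1 0))).
  by apply: rat2_ext h _ => y z _; rewrite det2.
have d0 y z : X (y, z) -> \det (M y z) != 0 by move=> /Mu; rewrite unitmxE unitfE.
have num : rational2_on X (fun y z => if i == j then M y z (1 - i) (1 - j) else - M y z i j).
  by case: (i == j); [exact: hM|exact: rat2N (hM i j)].
apply: rat2_ext (rat2M (rat2V dM d0) num) _ => y z /d0 D0.
by rewrite invmx2.
Qed.

End Rational.

(** * Rational solutions of the hypergeometric equation *)

Section Global.
Variable R : realType.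
Notation C := (Cx R).
Notation hderC := (@hder (R[i] : numFieldType)).
Notation K := (Num.NumField.sort (R[i] : numFieldType)).

Section Solutions.
Variables (rho : R[i]) (m : int) (psi : 'I_2 -> C -> C).
Hypothesis rho0 : rho != 0.
Hypothesis rhoE : rho = m%:~R.
Let S := [set v : C | v != 0 /\ v != 1].
Hypothesis psirat : forall k, rational_on S (psi k).
Hypothesis psieq : forall k v, S v -> psi_eq_at rho (psi k) v.
Hypothesis psiind : lin_indep_on S psi.

Notation along := (@solves_along (R[i] : numFieldType) rho).

Lemma S_ball (v : K) : S v -> exists2 r : R, 0 < r & disc (v : C) r `<=` S.
Proof.
move=> [v0 v1]; have n0 : 0 < `|v| :> R[i] by rewrite normr_gt0.
have n1 : 0 < `|v - 1| :> R[i] by rewrite normr_gt0 subr_eq0.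
have [e0 r0] := posC n0; have [e1 r1] := posC n1.
exists (Num.min (complex.Re `|v : K|) (complex.Re `|v - 1 : K|)).
  by rewrite lt_min r0 r1.
have m0 : (Num.min (complex.Re `|v : K|) (complex.Re `|v - 1 : K|))%:C <= `|v| :> R[i].
  by rewrite [leRHS]e0 lecR ge_min lexx.
have m1 : (Num.min (complex.Re `|v : K|) (complex.Re `|v - 1 : K|))%:C <= `|v - 1| :> R[i].
  by rewrite [leRHS]e1 lecR ge_min lexx orbT.
move=> w; rewrite /disc /= => wv; split; apply: contraTneq wv => ->.
  by rewrite sub0r normrN (le_gtF m0).
by rewrite distrC (le_gtF m1).
Qed.

Lemma psi_hder k v : S v -> hderC (psi k) v (derive1 (psi k) v) /\
  hderC (derive1 (psi k)) v (gauss2 rho v (psi k v) (derive1 (psi k) v)).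
Proof. by move=> Sv; have [v0 v1] := Sv; exact: psi_eq_hder (psieq k Sv) v0 v1. Qed.

Lemma psi_along k (u : K -> K) t du : hderC u t du -> S (u t) ->
  along (fun t => psi k (u t)) (fun t => derive1 (psi k) (u t)) u t du.
Proof.
move=> ud Su; have [h h'] := psi_hder k Su; split => //.
  exact: (@hder_comp R[i] (psi k) u t _ _ h ud).
exact: (@hder_comp R[i] (derive1 (psi k)) u t _ _ h' ud).
Qed.

Lemma S_near v : S v -> \forall w \near (v : K), S w.
Proof.
move=> Sv; have [r r0 rS] := S_ball Sv.
by apply/nearP_dist; exists r%:C; [rewrite ltcR|exact: rS].
Qed.

(* S is not convex: the combination vanishes near v by uniqueness on a disc, then
   everywhere because its numerator is a polynomial. *)
Lemma psi_comb_ext a0 a1 v : S v ->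
  a0 * psi 0 v + a1 * psi 1 v = 0 :> R[i] ->
  a0 * derive1 (psi 0) v + a1 * derive1 (psi 1) v = 0 :> R[i] ->
  forall w, S w -> a0 * psi 0 w + a1 * psi 1 w = 0 :> R[i].
Proof.
move=> Sv h h'.
have [r r0 rS] := S_ball Sv.
have [p0 [q0 E0]] := psirat 0; have [p1 [q1 E1]] := psirat 1.
have vr : disc v r v by rewrite /disc /= subrr normr0 ltcR.
pose P := a0 *: (p0 * q1) + a1 *: (p1 * q0).
have PE w : S w -> a0 * psi 0 w + a1 * psi 1 w = P.[w] / (q0.[w] * q1.[w]) :> R[i].
  move=> Sw; have [n0 ->] := E0 _ Sw; have [n1 ->] := E1 _ Sw.
  rewrite /P hornerD !hornerZ !hornerM; move: n0 n1.
  move: (p0.[w]) (p1.[w]) (q0.[w]) (q1.[w]) => A0 A1 B0 B1 n0 n1.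
  have -> : a0 * (A0 / B0) + a1 * (A1 / B1) =
      (a0 * (A0 * B1) + a1 * (A1 * B0)) / (B0 * B1) :> R[i].
    by field; rewrite n0 n1.
  by [].
have den0 w : S w -> q0.[w] * q1.[w] != 0.
  by move=> Sw; have [n0 _] := E0 _ Sw; have [n1 _] := E1 _ Sw; rewrite mulf_neq0.
suff P0 : P = 0 by move=> w Sw; rewrite PE // P0 horner0 mul0r.
apply: (@poly_eq0_near R[i] P v r%:C); first by rewrite ltcR.
move=> w wr; have Sw := rS _ wr.
have U := @along_uniq R rho (fun z => a0 * psi 0 z + a1 * psi 1 z)
   (fun z => a0 * derive1 (psi 0) z + a1 * derive1 (psi 1) z) (fun z => z) (fun=> 1) v w.
have [t t01 x|g _] := U _ h h'.
  have Dt : disc v r x by apply: disc_segment => //; rewrite subrKC.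
  have [x0 x1] := rS _ Dt.
  split; [|exact: x0|exact: x1|by exists 0; exact: hder_cst].
  have al k := psi_along k (hder_id x) (rS _ Dt).
  exact: solves_along_comb (al 0) (al 1).
by move/eqP: g; rewrite PE // mulf_eq0 invr_eq0 (negPf (den0 _ Sw)) orbF => /eqP.
Qed.

Lemma psi_wronskian v : S v ->
  psi 0 v * derive1 (psi 1) v - psi 1 v * derive1 (psi 0) v != 0.
Proof.
move=> Sv; apply: (@wronskian_neq0 R C S psi (fun k => derive1 (psi k)) v psiind).
by move=> a0 a1; exact: psi_comb_ext.
Qed.

(** The fraction represents psi only on S, but S is open, so the quotient rule gives psi' there as
    well. *)
Lemma dpsi_rat k : rational_on S (derive1 (psi k)).
Proof.
have [p [q E]] := psirat k; exists (p^`() * q - p * q^`()), (q * q) => v Sv.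
have [q0 _] := E _ Sv; rewrite hornerM mulf_neq0 //; split => //.
have [h _] := psi_hder k Sv.
have h2 := hderM (hder_horner p v) (hderV q0 (hder_horner q v)).
have near_eq : \forall w \near (v : K), p.[w] * (q.[w])^-1 = psi k w.
  by apply: filterS (S_near Sv) => w /E[].
rewrite (hder_uniq h (hder_near h2 near_eq)) hornerD hornerN !hornerM.
move: (p.[v]) (q.[v]) (p^`().[v]) (q^`().[v]) q0 => A B A' B' B0.
have -> : A' / B + A * (- B' / B ^+ 2) = (A' * B - A * B') / (B * B) :> R[i].
  by field.
by [].
Qed.

Lemma rat2_comp X (f : C -> C) (u : K -> K -> K) : rational_on S f -> rational2_on X u ->
  (forall y z, X (y, z) -> S (u y z)) -> rational2_on X (fun y z => f (u y z)).
Proof.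
move=> [p [q E]] hu uS.
have q0 y z (yz : X (y, z)) := (E _ (uS y z yz)).1.
have h := rat2M (rat2_horner p hu) (rat2V (rat2_horner q hu) q0).
by apply: rat2_ext h _ => y z /uS /E[].
Qed.

Let Fs k (p : C * C) := psi k (s p).
Let Fs' k (p : C * C) := derive1 (psi k) (s p).
Let Hs k (z : C) := psi k (- z).
Let Hs' k (z : C) := derive1 (psi k) (- z).
Let as_ (y : C) : C := (1 + y) ^ (- m).
Let bs (p : C * C) : C := (1 + p.1 + p.1 * p.2) ^ (- m).
Let cs (z : C) : C := z ^ (- m).
Let ds (z : C) : C := (1 + z) ^ (- m).
Let X := kz_domain (R := R).

Lemma X_facts y z : X (y, z) -> [/\ (z : R[i]) != 0, 1 + z != 0 :> R[i], 1 + y != 0 :> R[i],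
   1 + y + y * z != 0 :> R[i] & S (s (y, z)) /\ S (- z)].
Proof.
move=> yz; have [s0 s1] := kz_domain_s yz; have [/= z0 z1 y1 yz0] := yz.
split => //; try by rewrite addrC -[1]opprK subr_eq0.
by split => //; split; [rewrite oppr_eq0|rewrite eqr_oppLR].
Qed.

Lemma global_kz_data : kz_data rho X as_ bs Fs Fs' cs ds Hs Hs'.
Proof.
have rhoN : (- m)%:~R = - rho :> R[i] by rewrite rhoE mulrNz.
split.
- by [].
- move=> y z /X_facts[z0 z1 y1 yz0 _]; split => /=; rewrite ?oppr_eq0 ?oner_eq0 //.
  + by rewrite -subr_eq0 opprK addrC.
  + by rewrite eq_sym oppr_eq0 oner_eq0.
  + by rewrite mul0r !addr0 oner_eq0.
- by move=> y z /X_facts[z0 z1 y1 yz0 _]; rewrite expfz_neq0.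
- by move=> y z /X_facts[z0 z1 y1 yz0 _]; rewrite expfz_neq0.
- by move=> y z /X_facts[z0 z1 y1 yz0 _]; rewrite expfz_neq0.
- by move=> y z /X_facts[z0 z1 y1 yz0 _]; rewrite expfz_neq0.
- move=> y z /X_facts[z0 z1 y1 yz0 _].
  apply: hder_eq (hder_exprz (- m) y1 (hderD (hder_cst 1 (y : K)) (hder_id (y : K)))) _.
  by rewrite add0r mul1r rhoN.
- move=> y z /X_facts[z0 z1 y1 yz0 _].
  have ud := hderD (hderD (hder_cst 1 (y : K)) (hder_id (y : K)))
    (hderMr (z : K) (hder_id (y : K))).
  have h := @hder_exprz R[i] (fun t => 1 + t + t * z) (- m) y _ yz0 ud.
  by apply: hder_eq h _; rewrite add0r mul1r rhoN mulrA.
- move=> y z /X_facts[z0 z1 y1 yz0 _].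
  have ud := hderD (hder_cst (1 + y : R[i]) (z : K)) (hderMl (y : K) (hder_id (z : K))).
  have h := @hder_exprz R[i] (fun t => 1 + y + y * t) (- m) z _ yz0 ud.
  by apply: hder_eq h _; rewrite add0r mulr1 rhoN mulrA.
- move=> y z /X_facts[z0 z1 y1 yz0 _].
  apply: hder_eq (hder_exprz (- m) z0 (hder_id (z : K))) _.
  by rewrite mul1r rhoN.
- move=> y z /X_facts[z0 z1 y1 yz0 _].
  apply: hder_eq (hder_exprz (- m) z1 (hderD (hder_cst 1 (z : K)) (hder_id (z : K)))) _.
  by rewrite add0r mul1r rhoN.
- move=> k y z /X_facts[z0 z1 y1 yz0 [Ss _]].
  exact: (@psi_along k (fun t => s (t, z)) _ _ (s_dery y z0) Ss).
- move=> k y z /X_facts[z0 z1 y1 yz0 [Ss _]].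
  exact: (@psi_along k (fun t => s (y, t)) _ _ (s_derz y z0) Ss).
- move=> k y z /X_facts[z0 z1 y1 yz0 [_ Sz]].
  exact: (@psi_along k (fun t => - t) _ _ (hderN (hder_id (z : K))) Sz).
- by move=> y z /X_facts[_ _ _ _ [Ss _]]; exact: psi_wronskian.
- by move=> y z /X_facts[_ _ _ _ [_ Sz]]; exact: psi_wronskian.
Qed.

(** Here the psi_k are rational and the powers have integer exponents, so each factor of W is
    rational; the inverse at y = 0 is handled by the adjugate formula. *)
Lemma global_rational i j :
  rational2_on X (fun y z => W rho as_ bs Fs Fs' cs ds Hs Hs' y z i j).
Proof.
have sr := rat2_s (@subset_refl _ X).
have Fr k : rational2_on X (fun y z => Fs k (y, z)).
  by apply: rat2_comp (psirat k) sr _ => y z /X_facts[_ _ _ _ []].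
have F'r k : rational2_on X (fun y z => Fs' k (y, z)).
  by apply: rat2_comp (dpsi_rat k) sr _ => y z /X_facts[_ _ _ _ []].
have zr := rat2N (rat2_z X).
have Hr k : rational2_on X (fun _ z => Hs k z).
  by apply: rat2_comp (psirat k) zr _ => y z /X_facts[_ _ _ _ []].
have H'r k : rational2_on X (fun _ z => Hs' k z).
  by apply: rat2_comp (dpsi_rat k) zr _ => y z /X_facts[_ _ _ _ []].
have y1r := rat2D (rat2_cst X 1) (rat2_y X).
have ar : rational2_on X (fun y _ => as_ y).
  by apply: rat2Xz y1r _ => y z /X_facts[].
have br : rational2_on X (fun y z => bs (y, z)).
  by apply: rat2Xz (rat2D y1r (rat2M (rat2_y X) (rat2_z X))) _ => y z /X_facts[].
have cr : rational2_on X (fun _ z => cs z).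
  by apply: rat2Xz (rat2_z X) _ => y z /X_facts[].
have dr : rational2_on X (fun _ z => ds z).
  by apply: rat2Xz (rat2D (rat2_cst X 1) (rat2_z X)) _ => y z /X_facts[].
have W1r : mxrat2 X (fun y z => W1 rho as_ bs Fs Fs' y z).
  move=> k l; have h := rat2M (rat2M ar br) (rat2D (rat2M (Fr l) (rat2_cst X (w1 R k 0)))
    (rat2N (rat2M (rat2M (rat2M sr (rat2_cst X (sqrt3 R * rho)^-1)) (F'r l))
      (rat2_cst X (w2 R k 0))))).
  by apply: rat2_ext h _ => y z _; rewrite W1E [RHS]mxE /solvec !mxE.
have W2r : mxrat2 X (fun y z => W2 rho cs ds Hs Hs' z).
  move=> k l; have h := rat2M (rat2M cr dr) (rat2D (rat2M (Hr l) (rat2_cst X (v1 R k 0)))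
    (rat2N (rat2M (rat2M (rat2M zr (rat2_cst X (sqrt3 R * rho)^-1)) (H'r l))
      (rat2_cst X ((- v2 R) k 0))))).
  by apply: rat2_ext h _ => y z _; rewrite W2E [RHS]mxE /solvec !mxE.
have base y z : X (y, z) -> X (0, z) := @kz_base _ _ _ _ _ _ _ _ _ _ _ global_kz_data y z.
have W10r : mxrat2 X (fun y z => W1 rho as_ bs Fs Fs' 0 z).
  move=> k l.
  exact: (@rat2_base R X (fun y z => W1 rho as_ bs Fs Fs' y z k l) base (W1r k l)).
have unit0 y z : X (y, z) -> W1 rho as_ bs Fs Fs' 0 z \in unitmx.
  by move=> /base; exact: (W1_unit rho0 global_kz_data).
exact: mxrat2M (mxrat2M W1r (mxrat2V W10r unit0)) W2r i j.
Qed.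

End Solutions.
End Global.

(** * Terminating hypergeometric series *)

Section HypergeometricPolynomial.
Variable K : numFieldType.
Implicit Types (al be ga : K) (p : {poly K}).

(** The coefficient of X^k in the equation is the difference of the two sides of the recurrence at
    k. *)
Lemma gauss_poly al be ga p :
  (forall k, (k.+1%:R * (k%:R + ga)) * p`_k.+1 = ((k%:R + al) * (k%:R + be)) * p`_k) ->
  'X * (1 - 'X) * p^`()^`() + (ga%:P - (al + be + 1)%:P * 'X) * p^`()
    - (al * be)%:P * p = 0.
Proof.
move=> rec.
have -> : 'X * (1 - 'X) * p^`()^`() + (ga%:P - (al + be + 1)%:P * 'X) * p^`()
    - (al * be)%:P * p
  = 'X * p^`()^`() - 'X * ('X * p^`()^`()) + ga%:P * p^`()
    - (al + be + 1)%:P * ('X * p^`()) - (al * be)%:P * p.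
  by ring.
apply/polyP => k; rewrite !coefD !coefN !coefCM !coefXM coef0.
have := rec k.
case: k => [|[|k]] /=; rewrite !coef_deriv => h.
- rewrite [X in X = _](_ : _ =
      1%:R * (0 + ga) * p`_1 - (0 + al) * (0 + be) * p`_0); last by ring.
  by rewrite h subrr.
- rewrite [X in X = _](_ : _ =
      2 * (1 + ga) * p`_2 - (1 + al) * (1 + be) * p`_1); last by ring.
  by rewrite h subrr.
- rewrite [X in X = _](_ : _ = k.+3%:R * (k.+2%:R + ga) * p`_k.+3
      - (k.+2%:R + al) * (k.+2%:R + be) * p`_k.+2).
    by rewrite h subrr.
  by ring.
Qed.

(** A Frobenius series at 0 with exponent j: the condition on j is the indicial equation, and the
    factor vanishing at n ends the series there. *)
Lemma gauss_poly_exists al be ga (j n : nat) : (j <= n)%N ->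
  (j = 0%N \/ j.-1%:R + ga = 0) -> (n%:R + al) * (n%:R + be) = 0 ->
  (forall k, (j <= k < n)%N -> k%:R + ga != 0) ->
  exists p, [/\ p`_j = 1, forall k, (k < j)%N -> p`_k = 0 &
    forall k, (k.+1%:R * (k%:R + ga)) * p`_k.+1 = ((k%:R + al) * (k%:R + be)) * p`_k].
Proof.
move=> jn j0 n0 ga0.
pose r k : K := (k%:R + al) * (k%:R + be) / (k.+1%:R * (k%:R + ga)).
pose c k : K := if (j <= k)%N then \prod_(j <= i < k) r i else 0.
exists (\poly_(k < n.+1) c k); split=> [|k kj|k]; rewrite !coef_poly.
- by rewrite ltnS jn /c leqnn big_geq.
- by rewrite /c [(j <= k)%N]leqNgt kj /= if_same.
rewrite !ltnS; case: (ltngtP k n) => [kn|kn|->]; last by rewrite mulr0 n0 mul0r.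
- rewrite /c; case: (leqP j k) => jk.
    rewrite (leqW jk) big_nat_recr //= mulrCA mulrC; congr (_ * _).
    rewrite /r mulrC divfK // mulf_neq0 ?pnatr_eq0 // ga0 //.
    by rewrite jk.
  rewrite mulr0; case: (leqP j k.+1) => jk1; last by rewrite mulr0.
  (* At the junction the next coefficient is 1 while the current one is 0; the indicial condition
     kills the left side. *)
  have jE : j = k.+1 by apply/eqP; rewrite eqn_leq jk1 jk.
  by case: j0 => [j0|]; [rewrite j0 in jE|rewrite jE /= => ->; rewrite mulr0 mul0r].
- by rewrite !mulr0.
Qed.

End HypergeometricPolynomial.

Lemma derive1_horner (K : numFieldType) (p : {poly K}) :
  derive1 (fun t => p.[t]) = fun t => p^`().[t].
Proof. by apply/funext => t; have [_] := hder_horner p t; rewrite derive1E. Qed.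

Section RationalFundamental.
Variable R : realType.
Notation C := (Cx R).
Notation K := (Num.NumField.sort (R[i] : numFieldType)).

Lemma gauss_at_poly (al be ga : R[i]) (p : {poly R[i]}) (v : K) :
  'X * (1 - 'X) * p^`()^`() + (ga%:P - (al + be + 1)%:P * 'X) * p^`() - (al * be)%:P * p = 0 ->
  gauss_at al be ga (fun t : C => p.[t] : C) v.
Proof.
move=> eq.
have d1 : derive1 (fun t : C => p.[t] : C) = fun t => p^`().[t] := derive1_horner p.
have d2 : derive1 (fun t : C => p^`().[t] : C) = fun t => p^`()^`().[t] :=
  derive1_horner p^`().
split; rewrite ?derive1nS ?derive1n1 ?d1 ?d2.
- exact: (@ex_derive _ _ _ _ _ _ _ (hder_horner p v)).
- exact: (@ex_derive _ _ _ _ _ _ _ (hder_horner p^`() v)).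
have := congr1 (fun q => q.[v]) eq.
by rewrite !(hornerD, hornerN, hornerM, hornerC, hornerX).
Qed.

(* The exponents at 0 are 0 and 2n; both power series terminate, in degrees n and
   3n. *)
Lemma poly_solutions (n : nat) : (0 < n)%N ->
  exists p : 'I_2 -> {poly R[i]}, let S := [set v : C | v != 0 /\ v != 1] in
  (forall k v, psi_eq_at (n%:R : R[i]) (fun t : C => (p k).[t] : C) v) /\
  lin_indep_on S (fun k (v : C) => (p k).[v] : C).
Proof.
move=> n0; pose rho : R[i] := n%:R.
have [p [p0 _ prec]] : exists p : {poly R[i]},
    [/\ p`_0 = 1, forall k, (k < 0)%N -> p`_k = 0 &
    forall k, (k.+1%:R * (k%:R + (1 - 2 * rho))) * p`_k.+1
      = ((k%:R - rho) * (k%:R - 3 * rho)) * p`_k].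
  apply: (@gauss_poly_exists R[i] (- rho) (- (3 * rho)) _ 0 n) => //;
    [by left|by rewrite subrr mul0r|].
  move=> k /andP[_ kn].
  have -> : k%:R + (1 - 2 * rho) = k.+1%:R - (2 * n)%:R :> R[i].
    by rewrite /rho -natr1 natrM; ring.
  by rewrite subr_eq0 eqr_nat neq_ltn; apply/orP; left; rewrite mul2n -addnn -addn1 leq_add.
have [q [q0 qlt qrec]] : exists q : {poly R[i]},
    [/\ q`_(2 * n) = 1, forall k, (k < 2 * n)%N -> q`_k = 0 &
    forall k, (k.+1%:R * (k%:R + (1 - 2 * rho))) * q`_k.+1
      = ((k%:R - rho) * (k%:R - 3 * rho)) * q`_k].
  apply: (@gauss_poly_exists R[i] (- rho) (- (3 * rho)) _ (2 * n) (3 * n)).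
  - by rewrite leq_mul2r orbT.
  (* At index 2n - 1 the factor k + gamma = k + 1 - 2n vanishes, so a series may start at 2n. *)
  - right; case: n n0 @rho p0 prec => // n _ rho _ _.
    have -> : (2 * n.+1).-1 = (2 * n).+1 by rewrite mulnS.
    by rewrite /rho -!natr1 natrM; ring.
  - by rewrite natrM subrr mulr0.
  - move=> k /andP[kn _].
    have -> : k%:R + (1 - 2 * rho) = k.+1%:R - (2 * n)%:R :> R[i].
      by rewrite /rho -natr1 natrM; ring.
    by rewrite subr_eq0 eqr_nat gtn_eqF.
exists (fun k => if k == 0 then p else q) => S; split.
  by move=> k v; apply: gauss_at_poly; apply: gauss_poly; case: (k == 0).
move=> a h.
pose P := a 0 *: p + a 1 *: q.
have P0 : P = 0.
  (* The open disc of centre 2 and radius 1 contains neither 0 nor 1. *)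
  apply: (@poly_eq0_near R[i] P 2 1) => // w w2.
  have Sw : S w.
    split; apply: contraTneq w2 => ->.
      by rewrite sub0r normrN normr_nat le_gtF ?ler1n.
    by rewrite distrC (_ : 2 - 1 = 1 :> R[i]) ?normr1 ?ltxx //; ring.
  have := h _ Sw.
  rewrite big_ord_recl big_ord1 /= (_ : lift 0 0 = 1 :> 'I_2); last exact: val_inj.
  by rewrite /P hornerD !hornerZ.
(* Independence is read off the lowest terms: q starts at X^(2n) with 2n > 0, so the constant term
   isolates a 0, and then the coefficient of X^(2n) isolates a 1. *)
have a0 : a 0 = 0.
  have := congr1 (fun r : {poly R[i]} => r`_0) P0.
  by rewrite coefD !coefZ coef0 p0 qlt ?muln_gt0 // mulr0 addr0 mulr1.
have a1 : a 1 = 0.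
  have := congr1 (fun r : {poly R[i]} => r`_(2 * n)) P0.
  by rewrite coefD !coefZ coef0 q0 a0 mul0r add0r mulr1.
by apply: ord2P.
Qed.

End RationalFundamental.

Lemma scale_mul_comb (K : numFieldType) (rho du p q : K) (A B : 'M[K]_2) :
  du *: (rho *: (p *: A + q *: B)) = rho *: ((du * p) *: A + (du * q) *: B).
Proof. by apply/matrixP => i j; rewrite !mxE; ring. Qed.

Lemma sub_comb (K : numFieldType) (rho p q r : K) (A B : 'M[K]_2) :
  rho *: ((p - r) *: A + (q - r) *: B) = rho *: (r *: - (A + B) + p *: A + q *: B).
Proof. by apply/matrixP => i j; rewrite !mxE; ring. Qed.

(** * Rational fundamental solutions for integer rho *)

Section Fundamental.
Variable R : realType.
Notation C := (Cx R).
Notation hderC := (@hder (R[i] : numFieldType)).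
Notation K := (Num.NumField.sort (R[i] : numFieldType)).
Notation mxderC := (@mxder (R[i] : numFieldType)).

Let trmxN (A : 'M[R[i]]_2) : (- A)^T = - A^T.
Proof. by apply/matrixP => i j; rewrite !mxE. Qed.

Lemma kz_domain_neq0 (y z : C) : kz_domain (y, z) ->
  [/\ z != 0 :> R[i], 1 + z != 0 :> R[i], 1 + y != 0 :> R[i] &
   1 + y + y * z != 0 :> R[i] /\ (z + 1 != 0 :> R[i] /\ y + 1 != 0 :> R[i])].
Proof.
move=> [/= z0 z1 y1 yz0].
have z1' : z + 1 != 0 :> R[i] by rewrite -[1]opprK subr_eq0.
have y1' : y + 1 != 0 :> R[i] by rewrite -[1]opprK subr_eq0.
by split => //; rewrite addrC.
Qed.

(* The KZ system in the variable s. *)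
Definition conn (rho v : R[i]) : 'M[R[i]]_2 :=
  rho *: (v^-1 *: P13 R + (v - 1)^-1 *: P14 R).

Lemma scale_conn rho v du al be : du / v = al -> du / (v - 1) = be ->
  du *: conn rho v = rho *: (al *: P13 R + be *: P14 R).
Proof.
by move=> <- <-; exact: scale_mul_comb.
Qed.

Lemma conn_kzY rho (y z : C) : kz_domain (y, z) ->
  ((z + 1) / z : R[i]) *: conn rho (s (y, z)) = kzY rho y z.
Proof.
move=> /kz_domain_neq0[z0 z1 y1 [yz0 [zc yc]]].
by apply: scale_conn; rewrite /s /=; field; rewrite ?z0 ?z1 ?y1 ?zc ?yc ?yz0.
Qed.

Lemma conn_kzZ rho (y z : C) : kz_domain (y, z) ->
  (- (y + 1) / z ^+ 2 : R[i]) *: conn rho (s (y, z)) = kzZ rho y z.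
Proof.
move=> /kz_domain_neq0[z0 z1 y1 [yz0 [zc yc]]].
rewrite (@scale_conn rho _ _ ((1 + z)^-1 - z^-1) (y / (1 + y + y * z) - z^-1)).
- have e43 : P R 4 3 = - (P13 R + P14 R) by exact: P_sum.
  have e42 : P R 4 2 = P13 R by [].
  have e41 : P R 4 1 = P14 R by [].
  by rewrite /kzZ e43 e42 e41; exact: sub_comb.
- by rewrite /s /=; field; rewrite ?z0 ?z1 ?y1 ?zc ?yc ?yz0.
- by rewrite /s /=; field; rewrite ?z0 ?z1 ?y1 ?zc ?yc ?yz0.
Qed.

Lemma conn_tr rho v : (conn rho v)^T = conn rho v.
Proof.
have tr2 (A B : 'M[R[i]]_2) x y :
    (rho *: (x *: A + y *: B))^T = rho *: (x *: A^T + y *: B^T).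
  by apply/matrixP => i j; rewrite !mxE.
rewrite /conn tr2.
have -> : (P13 R)^T = P13 R by apply/matrixP; apply: ord2P; apply: ord2P; rewrite !mxE.
by have -> : (P14 R)^T = P14 R by apply/matrixP; apply: ord2P; apply: ord2P; rewrite !mxE.
Qed.

(** The differential equation lives in the variable v; rationality is asked of the pull-back by [s],
    the form compared with W. *)
Definition rational_fundamental (rho : R[i]) (Phi : K -> 'M[R[i]]_2) :=
  (forall v, v != 0 -> v != 1 ->
     Phi v \in unitmx /\ mxderC Phi v (conn rho v *m Phi v)) /\
  mxrat2 (kz_domain (R := R)) (fun y z => Phi (s (y, z))).

Lemma rational_fundamental_pos (n : nat) : (0 < n)%N ->
  exists Phi, rational_fundamental n%:R Phi.
Proof.
move=> n0; pose rho : R[i] := n%:R.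
have rho0 : rho != 0 by rewrite pnatr_eq0 -lt0n.
have rhoE : rho = (n : int)%:~R by [].
have [p [pS pind]] := poly_solutions R n0.
pose psi k (v : C) : C := (p k).[v].
pose S := [set v : C | v != 0 /\ v != 1].
have psirat k : rational_on S (psi k).
  by exists (p k), 1 => v _; rewrite hornerC oner_eq0 divr1.
have psieq k v : S v -> psi_eq_at rho (psi k) v by move=> _; exact: pS.
(* Its logarithmic derivative is - rho (1 / v + 1 / (v - 1)), the scalar required by
   [shift_connection]. *)
pose pre (v : K) := (v * (v - 1)) ^ (- (n : int)).
pose Phi (v : K) := solmx (sqrt3 R) rho (w1 R) (w2 R) (pre v)
  (psi^~ v) (fun k => derive1 (psi k) v) v.
exists Phi; split=> [v v0 v1|].
  have v1' : v - 1 != 0 by rewrite subr_eq0.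
  have w0 : v * (v - 1) != 0 by rewrite mulf_neq0.
  have Sv : S v by [].
  split.
    rewrite unitmxE unitfE det_solmx oppr_eq0.
    apply: mulf_neq0; [apply: mulf_neq0; [apply: mulf_neq0|]|].
    - by rewrite expf_neq0 // expfz_neq0.
    - by rewrite mulf_neq0 // invr_eq0 mulf_neq0 // sqrt3_neq0.
    - exact: (psi_wronskian psirat psieq pind Sv).
    - by rewrite !mxE /= -expr2 sqrt3E; have -> : 3 - 1 * 1 = 2 :> R[i] by ring.
  have pred : hderC pre v (- rho * (v^-1 + (v - 1)^-1) * pre v).
    have ud := hderM (hder_id v) (hderB (hder_id v) (hder_cst 1 v)).
    have h := @hder_exprz R[i] (fun t => t * (t - 1)) (- (n : int)) v _ w0 ud.
    apply: hder_eq h _; rewrite mulrNz -rhoE; congr (- rho * _ * _).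
    by field; rewrite v0 v1'.
  have al k := psi_along psieq k (hder_id v) Sv.
  have h := @solmx_der R[i] (sqrt3 R) rho (sqrt3E R) rho0 (P13 R) (P14 R) (w1 R) (w2 R)
    pre id psi (fun k => derive1 (psi k)) v 1 _
    (P13w1 R) (P14w1 R) (P13w2 R) (P14w2 R) v0 v1' pred al.
  by apply: mxder_eq h _; rewrite /= !div1r shift_connection.
have dom y z : kz_domain (y, z) -> S (s (y, z)) by exact: kz_domain_s.
have sr := rat2_s (@subset_refl _ (kz_domain (R := R))).
have Fr k : rational2_on (kz_domain (R := R)) (fun y z => psi k (s (y, z))).
  by apply: rat2_comp (psirat k) sr _.
have F'r k : rational2_on (kz_domain (R := R)) (fun y z => derive1 (psi k) (s (y, z))).
  by apply: rat2_comp (dpsi_rat psirat psieq k) sr _.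
have pr : rational2_on (kz_domain (R := R)) (fun y z => pre (s (y, z))).
  apply: rat2Xz (rat2M sr (rat2D sr (rat2_cst _ (-1)))) _ => y z /dom[s0 s1].
  by rewrite mulf_neq0 // subr_eq0.
move=> k l; have h := rat2M pr (rat2D (rat2M (Fr l) (rat2_cst _ (w1 R k 0)))
  (rat2N (rat2M (rat2M (rat2M sr (rat2_cst _ (sqrt3 R * rho)^-1)) (F'r l))
    (rat2_cst _ (w2 R k 0))))).
by apply: rat2_ext h _ => y z _; rewrite [RHS]mxE /solvec !mxE.
Qed.

(** If Psi' = - C Psi, then the inverse satisfies (Psi^-1)' = Psi^-1 C; transposing and using that C
    is symmetric gives a solution for C. *)
Lemma rational_fundamental_opp rho Psi :
  rational_fundamental (- rho) Psi -> rational_fundamental rho (fun v => (invmx (Psi v))^T).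
Proof.
move=> [PsiP Psir]; split=> [v v0 v1|i j].
  have [Pu Pd] := PsiP v v0 v1; split; first by rewrite unitmx_tr unitmx_inv.
  apply: mxder_eq (mxder_tr (mxderV Pu Pd)) _.
  rewrite -!mulmxA mulmxV // mulmx1 trmxN trmx_mul conn_tr.
  by rewrite /conn scaleNr mulNmx opprK.
have unit_s y z : kz_domain (y, z) -> Psi (s (y, z)) \in unitmx.
  by move=> /kz_domain_s[s0 s1]; have [] := PsiP _ s0 s1.
by apply: rat2_ext (mxrat2V Psir unit_s j i) _ => y z _; rewrite mxE.
Qed.

Lemma rational_fundamental_exists (rho : R[i]) (m : int) : rho != 0 -> rho = m%:~R ->
  exists Phi, rational_fundamental rho Phi.
Proof.
case: m => n rho0 rhoE.
  by rewrite rhoE; apply: rational_fundamental_pos; rewrite lt0n -(pnatr_eq0 R[i]) -[_%:R]rhoE.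
have [Psi h] := @rational_fundamental_pos n.+1 isT.
by eexists; apply: (@rational_fundamental_opp rho Psi); rewrite rhoE NegzE mulrNz opprK.
Qed.

Lemma gauge_der (A B : K -> 'M[R[i]]_2) t Z : A t \in unitmx ->
  mxderC A t (Z *m A t) -> mxderC B t (Z *m B t) ->
  mxderC (fun u => invmx (A u) *m B u) t 0.
Proof.
move=> Au Ad Bd; apply: mxder_eq (mxderM (mxderV Au Ad) Bd) _.
by rewrite -!mulmxA mulmxV // mulmx1 mulNmx -mulmxA addNr.
Qed.

(** The uniqueness lemma is applied to f - f p, with a system whose coefficients are all zero. *)
Lemma hder0_disc (f : K -> K) (c : C) (r : R) (p q : K) :
  (forall x : K, disc c r x -> hderC f x 0) -> disc c r p -> disc c r q -> f q = f p.
Proof.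
move=> f0 Dp Dq.
have := @linear_system_uniq R (fun x => f x - f p) (fun=> 0) (fun=> 0) (fun=> 0)
  (fun=> 0) p (q - p).
rewrite subrKC => U; apply/eqP; rewrite -subr_eq0; apply/eqP.
apply: (U _ _ _).1 => // [t t01|]; last by rewrite subrr.
have Dt : disc c r (p + t%:C * (q - p)) by apply: disc_segment => //; rewrite subrKC.
have z0 : diffC (fun=> 0) (p + t%:C * (q - p)) by exists 0; exact: hder_cst.
split => //.
  by apply: hder_eq (hderB (f0 _ Dt) (hder_cst _ _)) _; rewrite mul0r subrr.
by apply: hder_eq (hder_cst 0 _) _; rewrite !mul0r addr0.
Qed.

Lemma mxder_comp (M : K -> 'M[R[i]]_2) (u : K -> K) t D du :
  mxderC M (u t) D -> hderC u t du -> mxderC (fun x => M (u x)) t (du *: D).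
Proof.
move=> Md ud i j; apply: hder_eq (hder_comp (Md i j) ud) _.
by rewrite mxE mulrC.
Qed.

(** Stated for an arbitrary fundamental solution: whatever branches were chosen, V differs from the
    pull-back of Phi by a constant matrix on the right. *)
Lemma kz_rational (rho : R[i]) (m : int) (y0 z0 : C) (r1 r2 : R) (V : C -> C -> 'M[R[i]]_2) :
  let X := disc y0 r1 `*` disc z0 r2 in
  rho != 0 -> rho = m%:~R -> disc y0 r1 0 -> 0 < r2 -> X `<=` kz_domain (R := R) ->
  kz_fundamental_on rho X V ->
  forall i j, rational2_on X (fun y z => V y z i j).
Proof.
move=> X rho0 rhoE D10 r20 Xd VX.
have [Phi [PhiP Phir]] := rational_fundamental_exists rho0 rhoE.
have D2z0 : disc z0 r2 z0 by rewrite /disc /= subrr normr0 ltcR.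
pose A y z := Phi (s (y, z)).
have Au y z : X (y, z) -> A y z \in unitmx.
  by move=> /Xd/kz_domain_s[s0 s1]; have [] := PhiP _ s0 s1.
have Ay y z : X (y, z) -> mxderC (fun t => A t z) y (kzY rho y z *m A y z).
  move=> /Xd yz; have [z_0 _ _ _] := kz_domain_neq0 yz.
  have [s0 s1] := kz_domain_s yz; have [_ Pd] := PhiP _ s0 s1.
  have h := @mxder_comp Phi (fun t => s (t, z)) y _ _ Pd (s_dery y z_0).
  by apply: mxder_eq h _; rewrite scalemxAl conn_kzY.
have Az y z : X (y, z) -> mxderC (fun t => A y t) z (kzZ rho y z *m A y z).
  move=> /Xd yz; have [z_0 _ _ _] := kz_domain_neq0 yz.
  have [s0 s1] := kz_domain_s yz; have [_ Pd] := PhiP _ s0 s1.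
  have h := @mxder_comp Phi (fun t => s (y, t)) z _ _ Pd (s_derz y z_0).
  by apply: mxder_eq h _; rewrite scalemxAl conn_kzZ.
pose G y z := invmx (A y z) *m V y z.
(* Both partial derivatives of [G] vanish, so it is constant along the path from (y, z) to (0, z)
   and on to (0, z0), where z0 is the centre of the second disc. *)
have Gconst y z : X (y, z) -> G y z = G 0 z0.
  move=> [/= Dy Dz]; apply/matrixP => i j; transitivity (G 0 z i j).
    apply: (@hder0_disc (fun t => G t z i j) y0 r1) => // x Dx.
    have Xx : X (x, z) by [].
    have [_ Vy _] := VX _ _ Xx.
    have := @gauge_der (fun t => A t z) (fun t => V t z) x _
      (Au _ _ Xx) (Ay _ _ Xx) Vy i j.
    by rewrite mxE.
  apply: (@hder0_disc (fun t => G 0 t i j) z0 r2) => // x Dx.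
  have Xx : X (0, x) by [].
  have [_ _ Vz] := VX _ _ Xx.
  have := @gauge_der (fun t => A 0 t) (fun t => V 0 t) x _
    (Au _ _ Xx) (Az _ _ Xx) Vz i j.
  by rewrite mxE.
have AG : mxrat2 X (fun y z => A y z *m G 0 z0).
  apply: mxrat2M => k l; last exact: rat2_cst.
  exact: rat2_sub Xd (Phir k l).
move=> i j; apply: rat2_ext (AG i j) _ => y z yz.
by rewrite -(Gconst y z yz) /G mulKVmx // Au.
Qed.

End Fundamental.

Theorem theorem3p1 (R : realType) (rho : Cx R) (rho_neq0 : rho != 0) :
  (forall (v0 : Cx R) (r0 : R) (psi : 'I_2 -> Cx R -> Cx R)
      (y0 z0 : Cx R) (r1 r2 : R)
      (a : Cx R -> Cx R) (b : Cx R * Cx R -> Cx R)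
      (F F' : 'I_2 -> Cx R * Cx R -> Cx R)
      (c d : Cx R -> Cx R) (H H' : 'I_2 -> Cx R -> Cx R),
    let D1 := disc y0 r1 in
    let D2 := disc z0 r2 in
    0 < r0 ->
    (forall v, disc v0 r0 v -> v != 0 /\ v != 1) ->
    (forall k v, disc v0 r0 v -> psi_eq_at rho (psi k) v) ->
    lin_indep_on (disc v0 r0) psi ->
    0 < r1 -> 0 < r2 -> D1 0 -> D1 `*` D2 `<=` kz_domain (R := R) ->
    power_branch D1 (fun y => 1 + y) (- rho) a ->
    power_branch (D1 `*` D2) (fun p => 1 + p.1 + p.1 * p.2) (- rho) b ->
    power_branch D2 (fun z => z) (- rho) c ->
    power_branch D2 (fun z => 1 + z) (- rho) d ->
    (forall k,
       continued_along rho (psi k) v0 (D1 `*` D2) (s (R := R)) (F k) (F' k)) ->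
    lin_indep_on (D1 `*` D2) F ->
    (forall k, continued_along rho (psi k) v0 D2 (fun z => - z) (H k) (H' k)) ->
    lin_indep_on D2 H ->
    kz_fundamental_on rho (D1 `*` D2) (W rho a b F F' c d H H') /\
    ((exists m : int, rho = m%:~R) ->
     forall i j,
       rational2_on (D1 `*` D2) (fun y z => W rho a b F F' c d H H' y z i j)))
  /\
  (forall (m : int) (psi : 'I_2 -> Cx R -> Cx R),
    let S := [set v : Cx R | v != 0 /\ v != 1] in
    let Wm := W rho
      (fun y => (1 + y) ^ (- m)) (fun p => (1 + p.1 + p.1 * p.2) ^ (- m))
      (fun k p => psi k (s p)) (fun k p => derive1 (psi k) (s p))
      (fun z => z ^ (- m)) (fun z => (1 + z) ^ (- m))
      (fun k z => psi k (- z)) (fun k z => derive1 (psi k) (- z)) in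
    rho = m%:~R ->
    (forall k, rational_on S (psi k)) ->
    (forall k v, S v -> psi_eq_at rho (psi k) v) ->
    lin_indep_on S psi ->
    kz_fundamental_on rho (kz_domain (R := R)) Wm /\
    (forall i j, rational2_on (kz_domain (R := R)) (fun y z => Wm y z i j))).
Proof.
split.
  move=> v0 r0 psi y0 z0 r1 r2 a b F F' c d H H' D1 D2 _ _ _ _ _ r20 D10 D12.
  move=> pa pb pc pd Fc Find Hc Hind.
  have fund : kz_fundamental_on rho (D1 `*` D2) (W rho a b F F' c d H H').
    apply: kz_core; first exact: rho_neq0.
    by apply: local_kz_data => //; [move=> k; case: (Fc k)|move=> k; case: (Hc k)].
  by split=> // -[m rhoE]; exact: kz_rational rho_neq0 rhoE D10 r20 D12 fund.
move=> m psi S Wm rhoE psirat psieq psiind; split.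
  have D := @global_kz_data R rho m psi rhoE psirat psieq psiind.
  by move=> y z; exact: (@kz_core R rho rho_neq0 _ _ _ _ _ _ _ _ _ D y z).
exact: global_rational rho_neq0 rhoE psirat psieq psiind.
Qed.
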